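(* There exist universal constants $0<a_1\leqslant a_2$ and, for each integer $d\geqslant 3$, constants $0<b_1(d)\leqslant b_2(d)$, $\tau'=\tau'(d)>0$ and $B_d>0$ such that the following holds. Let $k\geqslant n\geqslant d\geqslant 3$ be integers with $dn$ even, and set $$D:=\frac{3\log n}{\min\{\log n,\log\log k\}}.$$ Then there exists a metric space $\mathcal{M}=(M,\varrho)$ with $$\exp\Big(a_1\log^2 n\cdot\log\log n\cdot\min\{n,\log k\}\Big)\leqslant|M|\leqslant\exp\Big(a_2\log^2 n\cdot\log\log n\cdot\min\{n,\log k\}\Big)$$ such that for every connected $G\in G(n,d)$ with $\mathrm{diam}(G)\leqslant 500\log n$ we have $c_{\mathcal{M}}(G)\leqslant D$. Consequently (since $\min\{\log n,\log\log|M|\}$ and $\min\{\log n,\log\log k\}$ agree up to constant factors), $$\mathbb{P}_{G(n,d)}\bigg[G\colon b_1(d)\,\frac{\log n}{\min\{\log n,\log\log|M|\}}\leqslant c_{\mathcal{M}}(G)\leqslant b_2(d)\,\frac{\log n}{\min\{\log n,\log\log|M|\}}\bigg]\geqslant 1-\frac{B_d}{n^{\tau'}}.$$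
   Context: $G(n,d)$ denotes the set of all $d$-regular (simple) graphs on $[n]:=\{1,\dots,n\}$ and $\mathbb{P}_{G(n,d)}$ the uniform probability measure on $G(n,d)$; statements about $\mathbb{P}_{G(n,d)}$ are understood for those $n$ for which $G(n,d)\neq\emptyset$. $\log$ is the natural logarithm. For a graph $G$, $\mathrm{dist}_G$ is the shortest-path distance on its vertex set $V_G$, with the convention $\mathrm{dist}_G(v,u):=|V_G|$ if $v,u$ lie in different connected components; $\mathrm{diam}(G)$ is the diameter of $(V_G,\mathrm{dist}_G)$. $c_{\mathcal{M}}(G)$ is the (bi-Lipschitz) distortion of $(G,\mathrm{dist}_G)$ into $\mathcal{M}=(M,\varrho)$: the smallest $D>0$ for which there exist $f\colon V_G\to M$ and $s>0$ with $s\,\mathrm{dist}_G(v,u)\leqslant\varrho(f(v),f(u))\leqslant sD\,\mathrm{dist}_G(v,u)$ for all $v,u\in V_G$ (and $\infty$ if there is none). *)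

(* Defs.v *)
From HB Require Import structures.
From mathcomp Require Import all_boot all_order all_algebra.
From mathcomp Require Import all_classical all_reals all_analysis.

Set Implicit Arguments.
Unset Strict Implicit.
Unset Printing Implicit Defensive.

Import Order.TTheory GRing.Theory Num.Theory.

Local Open Scope ring_scope.

Section Graphs.
Variable T : finType.
Implicit Types (G : {set {set T}}) (u v : T).

(* A simple graph on the vertex set T is identified with its set of edges,
   each edge being a 2-element subset of T. *)
Definition simple_graph G : bool := [forall e in G, #|e| == 2].

Definition adj G : rel T := fun u v => [set u; v]%SET \in G.

Definition regular G (d : nat) : bool :=
  [forall v, #|[set u | adj G v u]%SET| == d].

Definition graph_connected G : bool := [forall u, forall v, connect (adj G) u v].

(* A k-tuple p with [path (adj G) u p] is a walk of length k starting at u.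
   A shortest path has length < #|T|, so the minimum takes the default value
   #|T| exactly when u and v lie in different components. *)
Definition gdist G u v : nat :=
  \big[minn/#|T|]_(k < #|T| |
     [exists p : k.-tuple T, path (adj G) u p && (last u p == v)]) (k : nat).

Definition diam G : nat := \max_(u : T) \max_(v : T) gdist G u v.

(* The infimum in the extended reals; it is +oo if there is no admissible D,
   and is otherwise attained when #|T| >= 2 and M is finite. *)
Definition distortion (R : realType) (M : metricType R) G : \bar R :=
  ereal_inf [set D%:E | D in [set D : R | 0 < D /\
    exists (f : T -> M) (s : R), 0 < s /\
      forall v u : T,
        s * (gdist G v u)%:R <= mdist (f v) (f u) /\
        mdist (f v) (f u) <= s * D * (gdist G v u)%:R]%classic]%classic.

End Graphs.

Definition regular_graphs (n d : nat) : {set {set {set 'I_n}}} :=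
  [set G : {set {set 'I_n}} | simple_graph G && regular G d]%SET.

Definition uniform_pr (R : realType) (X : finType) (Omega A : {set X}) : R :=
  #|Omega :&: A|%:R / #|Omega|%:R.

(* Main.v *)
Require Import Defs.
From HB Require Import structures.
From mathcomp Require Import all_boot all_order all_algebra.
From mathcomp Require Import all_classical all_reals all_analysis.
From mathcomp Require Import zify ring lra.
From mathcomp Require Import finset.
Import Order.TTheory GRing.Theory Num.Theory.

(* The space M is a box {0..H}^m with the sup metric, H ~ 500 log^2 n and
   m ~ log^2 n * min(n, log k). Matousek's embedding, with coordinates dist(., A) for
   suitable random sets A, maps every connected graph of diameter <= H into it with
   distortion 2q - 1, q = ceil(log n / min(log n, log log k)).

   For the lower bound it suffices that G is an edge expander. Some coordinate of an
   embedding puts a fraction 1/(4m) of the vertices far from its median, since otherwise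
   more than half of the vertices would lie in one ball of radius of order log n; by
   expansion the far vertices and the other half of G are within distance O(log m), so
   a coordinate that is Lipschitz at scale s D forces D >= c log n / log m.

   Random regular graphs are expanders by a switching argument. For a vertex set S of
   size s, replacing an edge ab inside S and an edge ce outside by ac and be raises the
   number x of cut edges by 2. Iterating j times and summing over j, Vandermonde's
   identity gives P(cut = x) <= C(ds, x) / C(e1 + e2, e1) with e1 ~ ds/2 and
   e2 ~ d(n-s)/2; since d >= 3, this beats the C(n, s) choices of S. *)

Set Implicit Arguments.
Unset Strict Implicit.
Unset Printing Implicit Defensive.

Local Open Scope nat_scope.

(** * Graph distance and expansion *)

Lemma bigminn_leq_id (I : Type) (r : seq I) (x : nat) (P : pred I) (F : I -> nat) :
  \big[minn/x]_(i <- r | P i) F i <= x.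
Proof. by elim/big_rec: _ => // i y _ yx; rewrite geq_min yx orbT. Qed.

Lemma bigminn_leq (I : finType) (x : nat) (P : pred I) (F : I -> nat) (j : I) :
  P j -> \big[minn/x]_(i | P i) F i <= F j.
Proof.
move=> Pj; have : j \in index_enum I by rewrite mem_index_enum.
elim: (index_enum I) => // i s IH; rewrite inE big_cons => /predU1P[<-|js].
  by rewrite Pj geq_minl.
by case: ifP => _; rewrite ?geq_min IH ?orbT.
Qed.

Lemma bigminn_attained (I : Type) (r : seq I) (x : nat) (P : pred I) (F : I -> nat) :
  \big[minn/x]_(i <- r | P i) F i = x \/
  exists2 j, P j & \big[minn/x]_(i <- r | P i) F i = F j.
Proof.
elim/big_rec: _ => [|i y Pi IH]; first by left.
by case: leqP => // _; right; exists i.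
Qed.

Lemma leq_card_bigcup (I T : finType) (P : pred I) (F : I -> {set T}) :
  #|\bigcup_(i | P i) F i| <= \sum_(i | P i) #|F i|.
Proof.
elim/big_ind2: _ => [|m1 n1 m2 n2 h1 h2|//]; first by rewrite cards0.
by rewrite cardsU (leq_trans (leq_subr _ _)) // leq_add.
Qed.

Section GraphMetric.
Variables (T : finType) (G : {set {set T}}).
Implicit Types (u v w : T) (S : {set T}).

Lemma adj_sym : symmetric (adj G).
Proof. by move=> u v; rewrite /adj finset.setUC. Qed.

(** Shortening the walk to a simple path brings its length below [#|T|], into the range of the
    minimum that defines [gdist]. *)
Lemma gdist_le_size u (p : seq T) : path (adj G) u p -> gdist G u (last u p) <= size p.
Proof.
case/shortenP => p' pp' Up' subp'.
have lt : size p' < #|T| by rewrite -[_.+1]/(size (u :: p')) -(card_uniqP Up') max_card.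
have -> : last u p' = last u p' by [].
apply: leq_trans (uniq_leq_size _ subp'); last by case/andP: Up'.
apply: (@bigminn_leq _ #|T| _ (fun k : 'I_#|T| => k : nat) (Ordinal lt)) => /=.
by apply/existsP; exists (in_tuple p'); rewrite pp' eqxx.
Qed.

Lemma gdist_walk u v : connect (adj G) u v ->
  exists p, [/\ path (adj G) u p, last u p = v & size p = gdist G u v].
Proof.
case/connectP => p pp ->; case/shortenP: pp => p' pp' Up' _.
have lt : size p' < #|T| by rewrite -[_.+1]/(size (u :: p')) -(card_uniqP Up') max_card.
have lt2 := leq_ltn_trans (gdist_le_size pp') lt.
(* The minimum is either its default [#|T|], which the simple path [p'] excludes through [lt2], or
   is attained by an actual walk. *)
case: (bigminn_attained (index_enum 'I_#|T|) #|T|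
   (fun k : 'I_#|T| => [exists q : k.-tuple T, path (adj G) u q && (last u q == last u p')])
   (fun k => k : nat)) => [e|[k /existsP[q /andP[pq /eqP lq]] e]].
  by move: lt2; rewrite /gdist e ltnn.
by exists q; rewrite pq lq /gdist e size_tuple.
Qed.

Lemma gdist_le_diam u v : gdist G u v <= diam G.
Proof. apply: leq_trans (leq_bigmax u); exact: (leq_bigmax v). Qed.

Lemma gdistuu u : gdist G u u = 0.
Proof. by apply/eqP; rewrite -leqn0; exact: (@gdist_le_size u [::]). Qed.

Lemma walk_rev u p : path (adj G) u p ->
  exists q, [/\ path (adj G) (last u p) q, last (last u p) q = u & size q = size p].
Proof.
move=> pp; exists (rev (belast u p)); split.
- rewrite rev_path; rewrite (eq_path (e' := adj G)) // => a b /=; exact: adj_sym.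
- by case: p pp => //= a p _; rewrite rev_cons last_rcons.
- by rewrite size_rev size_belast.
Qed.

Hypothesis conn : graph_connected G.

Lemma graph_connectedP u v : connect (adj G) u v.
Proof. by move/forallP: conn => /(_ u)/forallP. Qed.

Lemma gdist_sym_le u v : gdist G v u <= gdist G u v.
Proof.
have [p [pp <- <-]] := gdist_walk (graph_connectedP u v).
have [q [pq lq <-]] := walk_rev pp.
by rewrite -[X in gdist G _ X]lq; apply: gdist_le_size.
Qed.

Lemma gdist_sym u v : gdist G u v = gdist G v u.
Proof. by apply/eqP; rewrite eqn_leq !gdist_sym_le. Qed.

Lemma gdist_triangle v u w : gdist G u w <= gdist G u v + gdist G v w.
Proof.
have [p [pp lp <-]] := gdist_walk (graph_connectedP u v).
have [q [pq lq <-]] := gdist_walk (graph_connectedP v w).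
rewrite -size_cat -lq -lp -last_cat; apply: gdist_le_size.
by rewrite cat_path pp lp.
Qed.

End GraphMetric.

Section Expansion.
Variables (T : finType) (G : {set {set T}}).
Implicit Types (u v w : T) (S A B : {set T}).

(** The edge boundary of [S]: orienting each cut edge out of [S] counts it exactly once. *)
Definition cross_arcs S : {set T * T} :=
  [set p | [&& p.1 \in S, p.2 \notin S & adj G p.1 p.2]].

(** A lower bound [1/K] on the edge-isoperimetric (Cheeger) constant, stated without division. *)
Definition edge_expander (K : nat) : bool :=
  [forall S : {set T}, (0 < #|S|) && (#|S|.*2 <= #|T|) ==> (#|S| <= K * #|cross_arcs S|)].

Definition nbhd S : {set T} := S :|: [set v | [exists u in S, adj G u v]].

Lemma sub_nbhd S : S \subset nbhd S.
Proof. exact: finset.subsetUl. Qed.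

Lemma iter_nbhdP j A v : v \in iter j nbhd A ->
  exists a p, [/\ a \in A, path (adj G) a p, last a p = v & size p <= j].
Proof.
elim: j v => [|j IH] v /=; first by exists v, [::].
rewrite inE => /orP[/IH[a [p [aA pp lp sp]]]|].
  by exists a, p; split=> //; apply: leq_trans sp _.
rewrite inE => /existsP[u /andP[/IH[a [p [aA pp lp sp]]] uv]].
by exists a, (rcons p v); split; rewrite ?rcons_path ?pp ?lp ?last_rcons ?size_rcons.
Qed.

Variable d : nat.
Hypothesis regG : regular G d.

Lemma regularP v : #|[set u | adj G v u]| = d.
Proof. by move/forallP: regG => /(_ v)/eqP. Qed.

(** Group the arcs by their outer end, which has only [d] neighbours. *)
Lemma cross_arcs_le S : #|cross_arcs S| <= d * #|nbhd S :\: S|.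
Proof.
rewrite mulnC -sum_nat_const.
have -> : #|cross_arcs S| = \sum_(v in nbhd S :\: S) #|[set p in cross_arcs S | p.2 == v]|.
  rewrite -sum1_card (partition_big snd (mem (nbhd S :\: S))) /=.
    by apply: eq_bigr => v _; rewrite -sum1_card; apply: eq_bigl => p; rewrite !inE.
  move=> [u v]; rewrite !inE /= => /and3P[uS vS uv]; rewrite vS /= (negbTE vS) /=.
  by apply/existsP; exists u; rewrite uS.
apply: leq_sum => v _; rewrite -(regularP v).
rewrite -(card_in_imset (f := fst) (D := [set p in cross_arcs S | p.2 == v])).
  apply/subset_leq_card/fintype.subsetP => u /imsetP[[a b]]; rewrite !inE /=.
  by move=> /andP[/and3P[_ _ h] /eqP <-] ->; rewrite adj_sym.
by move=> [a b] [a' b']; rewrite !inE /= => /andP[_ /eqP->] /andP[_ /eqP->] ->.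
Qed.

Variable K : nat.
Hypothesis expG : edge_expander K.

(** Edge expansion becomes vertex expansion: the neighbourhood gains a factor [1 + 1/(K d)] as long
    as [S] holds at most half of the vertices. *)
Lemma nbhd_growth S : #|S|.*2 <= #|T| -> (K * d).+1 * #|S| <= K * d * #|nbhd S|.
Proof.
move=> hS; have [->|S0] := posnP #|S|; first by rewrite muln0.
move/forallP: expG => /(_ S); rewrite S0 hS /= => h.
have h2 := cross_arcs_le S.
have -> : #|nbhd S| = #|S| + #|nbhd S :\: S|.
  by rewrite -{2}(finset.setIidPr (sub_nbhd S)) cardsID.
by rewrite mulSn mulnDr addnC leq_add2l (leq_trans h) // -mulnA leq_mul.
Qed.

Lemma iter_nbhd_growth j A : #|iter j nbhd A|.*2 <= #|T| ->
  (K * d).+1 ^ j * #|A| <= (K * d) ^ j * #|iter j nbhd A|.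
Proof.
elim: j => [|j IH] // h.
have hj : #|iter j nbhd A|.*2 <= #|T|.
  by apply: leq_trans h; rewrite leq_double; apply/subset_leq_card/sub_nbhd.
rewrite !expnS -mulnA (mulnC (K * d)) -(mulnA (_ ^ j)).
apply: leq_trans (leq_mul (leqnn ((K * d) ^ j)) (nbhd_growth hj)).
by rewrite (mulnCA (_ ^ j)) leq_mul // IH.
Qed.

Lemma iter_nbhd_half j A : (K * d) ^ j * #|T| < (K * d).+1 ^ j * #|A|.*2 ->
  #|T| < #|iter j nbhd A|.*2.
Proof.
move=> h; rewrite ltnNge; apply/negP => h2; have := iter_nbhd_growth h2.
have : (K * d) ^ j * #|iter j nbhd A|.*2 <= (K * d) ^ j * #|T| by rewrite leq_mul.
nia.
Qed.

(* A neighbourhood containing more than half of the vertices meets B. *)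
Lemma expander_close_sets j A B : (K * d) ^ j * #|T| < (K * d).+1 ^ j * #|A|.*2 ->
  #|T| <= #|B|.*2 -> exists a b, [/\ a \in A, b \in B & gdist G a b <= j].
Proof.
move=> /iter_nbhd_half hA hB.
have /set0Pn[b /setIP[/iter_nbhdP[a [p [aA pp lp sp]]] bB]] : iter j nbhd A :&: B != set0.
  rewrite -cards_eq0; apply/negP => /eqP h.
  by have := cardsUI (iter j nbhd A) B; have := subset_leq_card (subsetT (iter j nbhd A :|: B)); rewrite cardsT; lia.
by exists a, b; split => //; rewrite -lp (leq_trans _ sp) // gdist_le_size.
Qed.

(** The two [j]-neighbourhoods of [u] and [v] each hold more than half of the vertices, so they
    meet, and two walks of length at most [j] are joined at a common vertex. *)
Lemma expander_walk j u v : (K * d) ^ j * #|T| < (K * d).+1 ^ j * 2 ->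
  exists p, [/\ path (adj G) u p, last u p = v & size p <= j.*2].
Proof.
move=> h; have big w : #|T| < #|iter j nbhd [set w]|.*2.
  by apply: iter_nbhd_half; rewrite cards1.
have /set0Pn[w /setIP[/iter_nbhdP[a [p [aA pp lp sp]]] /iter_nbhdP[b [q [bB pq lq sq]]]]] :
    iter j nbhd [set u] :&: iter j nbhd [set v] != set0.
  rewrite -cards_eq0; apply/negP => /eqP h0.
  have := cardsUI (iter j nbhd [set u]) (iter j nbhd [set v]).
  have := subset_leq_card (subsetT (iter j nbhd [set u] :|: iter j nbhd [set v])); rewrite cardsT.
  by have := big u; have := big v; lia.
move: aA bB; rewrite !inE => /eqP au /eqP bv; subst a b.
have [r [pr lr sr]] := walk_rev pq.
exists (p ++ r); split; rewrite ?cat_path ?last_cat ?lp ?size_cat ?pp -?lq //=.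
by rewrite sr; lia.
Qed.

Lemma expander_connected j : (K * d) ^ j * #|T| < (K * d).+1 ^ j * 2 -> graph_connected G.
Proof.
move=> h; apply/forallP => u; apply/forallP => v.
by have [p [pp lp _]] := expander_walk u v h; apply/connectP; exists p.
Qed.

Lemma expander_diam j : (K * d) ^ j * #|T| < (K * d).+1 ^ j * 2 -> diam G <= j.*2.
Proof.
move=> h; apply/bigmax_leqP => u _; apply/bigmax_leqP => v _.
by have [p [pp <- sp]] := expander_walk u v h; apply: leq_trans (gdist_le_size pp) sp.
Qed.

Lemma iter_nbhd_card j A : #|iter j nbhd A| <= d.+1 ^ j * #|A|.
Proof.
elim: j => [|j IH]; first by rewrite mul1n.
rewrite expnS -mulnA /=; set S := iter j nbhd A in IH *.
suff h : #|nbhd S| <= d.+1 * #|S| by apply: leq_trans h _; rewrite leq_mul.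
apply: leq_trans (_ : #|S| + \sum_(u in S) d <= _); last by rewrite sum_nat_const -mulnS mulnC.
rewrite cardsU; apply: leq_trans (leq_subr _ _) _; rewrite leq_add2l.
have -> : [set v | [exists u in S, adj G u v]] = \bigcup_(u in S) [set v | adj G u v].
  apply/setP => v; rewrite inE; apply/existsP/bigcupP => [[u /andP[uS uv]]|[u uS uv]].
    by exists u; rewrite ?inE.
  by exists u; rewrite uS; move: uv; rewrite inE.
rewrite [X in _ <= X](eq_bigr (fun u => #|[set v | adj G u v]|)); last first.
  by move=> u _; rewrite regularP.
exact: leq_card_bigcup.
Qed.

End Expansion.

(** * Switchings *)

Lemma card_dep_pairs (X Y : finType) (A : {set X}) (B : X -> {set Y}) :
  #|[set p : X * Y | (p.1 \in A) && (p.2 \in B p.1)]| = \sum_(x in A) #|B x|.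
Proof.
rewrite -sum1_card [RHS](eq_bigr (fun x => \sum_(y in B x) 1)) => [|x _]; last by rewrite sum1_card.
by rewrite pair_big_dep; apply: eq_bigl => p; rewrite inE.
Qed.

Lemma eq_set2 (T : finType) (u v a b : T) :
  ([set u; v] == [set a; b]) = (u == a) && (v == b) || (u == b) && (v == a).
Proof.
apply/eqP/orP => [h|[] /andP[/eqP-> /eqP->] //]; last exact: setUC.
have: u \in [set a; b] by rewrite -h set21.
have: v \in [set a; b] by rewrite -h set22.
have: a \in [set u; v] by rewrite h set21.
have: b \in [set u; v] by rewrite h set22.
rewrite !inE => hb ha /pred2P[]ev /pred2P[]eu; subst v u; rewrite ?eqxx /= ?andbT; auto.
- by left; move: hb; rewrite orbb eq_sym.
- by left; move: ha; rewrite orbb eq_sym.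
Qed.

Section Switching.
Variables (T : finType) (d : nat).
Implicit Types (G : {set {set T}}) (S : {set T}) (a b c e u v : T).

Definition dreg : {set {set {set T}}} := [set G | simple_graph G && regular G d].

(** Ordered pairs: in a simple graph each edge inside [S] is counted twice, so [arcs_in] and
    [cross_arcs] together count the degrees over [S]. *)
Definition arcs_in G S : {set T * T} :=
  [set p | [&& p.1 \in S, p.2 \in S & adj G p.1 p.2]].

Lemma simple_neq G u v : simple_graph G -> adj G u v -> u != v.
Proof.
by move=> /forallP/(_ [set u; v])/implyP h /h; rewrite cards2; case: (u == v).
Qed.

Lemma arcs_in_cross G S : regular G d -> #|arcs_in G S| + #|cross_arcs G S| = d * #|S|.
Proof.
move=> rG.
have -> : #|arcs_in G S| = \sum_(u in S) #|[set v | adj G u v] :&: S|.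
  by rewrite -card_dep_pairs; apply: eq_card => p; rewrite !inE /= [(p.2 \in S) && _]andbC.
have -> : #|cross_arcs G S| = \sum_(u in S) #|[set v | adj G u v] :\: S|.
  by rewrite -card_dep_pairs; apply: eq_card => p; rewrite !inE.
rewrite -big_split /= mulnC -sum_nat_const; apply: eq_bigr => u _.
by rewrite cardsID (regularP rG).
Qed.

Lemma cross_arcsC G S : #|cross_arcs G (~: S)| = #|cross_arcs G S|.
Proof.
have inj : injective (fun p : T * T => (p.2, p.1)) by move=> [? ?] [? ?] [-> ->].
rewrite -(card_imset (cross_arcs G S) inj).
apply: eq_card => -[u v]; rewrite !inE /= negbK.
apply/and3P/imsetP => [[uS vS uv]|[[a b]]].
  by exists (v, u); rewrite // !inE /= vS uS adj_sym.
by rewrite !inE /= => /and3P[aS bS ab] [-> ->]; rewrite aS bS adj_sym.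
Qed.

Definition switch G a b c e : {set {set T}} :=
  (G :\: [set [set a; b]; [set c; e]]) :|: [set [set a; c]; [set b; e]].

(** In a simple graph the four vertices are automatically distinct: [a], [b] and [c], [e] lie on
    opposite sides of [S], and each pair is adjacent. *)
Definition switchable G S a b c e :=
  [&& a \in S, b \in S, c \notin S, e \notin S, adj G a b, adj G c e, ~~ adj G a c & ~~ adj G b e].

(** The reverse switching restores [G]; this makes the counting map in [cut_layer_step]
    injective. *)
Lemma switchK G S a b c e : switchable G S a b c e ->
  (switch G a b c e :\: [set [set a; c]; [set b; e]]) :|: [set [set a; b]; [set c; e]] = G.
Proof.
case/and5P=> aS bS cS eS /and4P[ab ce ac be].
apply/setP => x; rewrite !inE.
case: (x =P [set a; b]) => [->|_] /=; first by rewrite orbT; exact/esym.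
case: (x =P [set c; e]) => [->|_] /=; first by rewrite orbT; exact/esym.
case: (x =P [set a; c]) => [->|_] /=; first exact/esym/negbTE.
case: (x =P [set b; e]) => [->|_] /=; first exact/esym/negbTE.
by rewrite !orbF.
Qed.

Lemma adj_switch G a b c e u v : adj (switch G a b c e) u v =
  [&& [set u; v] != [set a; b], [set u; v] != [set c; e] & adj G u v]
  || ([set u; v] == [set a; c]) || ([set u; v] == [set b; e]).
Proof. by rewrite /adj /switch !inE negb_or -andbA orbA. Qed.

Lemma simple_switch G S a b c e : simple_graph G -> switchable G S a b c e ->
  simple_graph (switch G a b c e).
Proof.
move=> sG /and5P[aS bS cS eS _]; apply/forallP => x; apply/implyP; rewrite !inE.
have hx y z : y \in S -> z \notin S -> #|[set y; z]| == 2.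
  by rewrite cards2; case: (y =P z) => // -> ->.
case/or3P => [/andP[_ xG]|/eqP->|/eqP->]; try exact: hx.
by move/forallP: sG => /(_ x)/implyP; apply.
Qed.

Lemma sum_eq_set2 u a b : a != b -> \sum_v ([set u; v] == [set a; b] : nat) = (u == a) + (u == b).
Proof.
move=> ab.
have E v : ([set u; v] == [set a; b]) = (u == a) * (v == b) + (u == b) * (v == a) :> nat.
  rewrite eq_set2; case: (u =P a) => [->|_] /=; last by case: (u == b); case: (v == a).
  by rewrite (negbTE ab) /=; case: (v == b).
under eq_bigr do rewrite E.
rewrite big_split /= -!big_distrr /=.
have D z : \sum_v (v == z : nat) = 1.
  by rewrite (bigD1 z) //= eqxx big1 // => v /negbTE->.
by rewrite !D !muln1.
Qed.

Lemma regular_switch G S a b c e : G \in dreg -> switchable G S a b c e ->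
  regular (switch G a b c e) d.
Proof.
rewrite inE => /andP[sG rG] /and5P[aS bS cS eS /and4P[ab ce ac be]].
have nab := simple_neq sG ab; have nce := simple_neq sG ce.
have hne y z : y \in S -> z \notin S -> y != z by move=> yS; apply: contraNneq => <-.
apply/forallP => u; apply/eqP.
(* Removed edges are added on the left and new ones on the right, so no subtraction occurs. Summing
   over [v] compares degrees: each of [a], [b], [c], [e] lies on one removed and one new edge. *)
have E v : adj (switch G a b c e) u v + ([set u; v] == [set a; b]) + ([set u; v] == [set c; e])
    = adj G u v + ([set u; v] == [set a; c]) + ([set u; v] == [set b; e]).
  rewrite adj_switch.
  have ne y z y' z' : y \in S -> y' \notin S -> z' \notin S -> [set y; z] != [set y'; z'].
    by move=> yS y'S z'S; rewrite eq_set2 !(negbTE (hne _ _ yS _)) ?andbF.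
  have F y z : [set u; v] = [set y; z] -> adj G u v = adj G y z by rewrite /adj => ->.
  have n1 := ne a b c e aS cS eS.
  have n2 : [set a; b] != [set a; c].
    by rewrite eq_set2 eqxx (negbTE (hne b c bS cS)) (negbTE (hne a c aS cS)).
  have n3 : [set a; b] != [set b; e].
    by rewrite eq_set2 eqxx (negbTE (hne a e aS eS)) (negbTE nab).
  have n4 : [set c; e] != [set a; c].
    by rewrite eq_sym eq_set2 (negbTE (hne a c aS cS)) (negbTE (hne a e aS eS)).
  have n5 : [set c; e] != [set b; e].
    by rewrite eq_sym eq_set2 (negbTE (hne b c bS cS)) (negbTE (hne b e bS eS)).
  have n6 : [set a; c] != [set b; e].
    by rewrite eq_set2 (negbTE nab) (negbTE (hne a e aS eS)).
  case: ([set u; v] =P [set a; b]) => [h|_] /=.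
    by rewrite h (negbTE n1) (negbTE n2) (negbTE n3) (F _ _ h) ab.
  case: ([set u; v] =P [set c; e]) => [h|_] /=.
    by rewrite h (negbTE n4) (negbTE n5) (F _ _ h) ce.
  case: ([set u; v] =P [set a; c]) => [h|_] /=.
    by rewrite h (negbTE n6) (F _ _ h) (negbTE ac).
  case: ([set u; v] =P [set b; e]) => [h|_] /=; last by rewrite !orbF.
  by rewrite (F _ _ h) (negbTE be).
have C G' : #|[set v | adj G' u v]| = \sum_v (adj G' u v : nat).
  by rewrite -sum1dep_card [RHS]big_mkcond [LHS]big_mkcond; apply: eq_bigr => v _; case: adj.
have : \sum_v (adj (switch G a b c e) u v + ([set u; v] == [set a; b]) + ([set u; v] == [set c; e]))
    = \sum_v (adj G u v + ([set u; v] == [set a; c]) + ([set u; v] == [set b; e])).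
  by apply: eq_bigr => v _.
rewrite 4!big_split /= -(C G) -(C (switch _ _ _ _ _)) (regularP rG).
rewrite (sum_eq_set2 u nab) (sum_eq_set2 u nce).
rewrite (sum_eq_set2 u (hne a c aS cS)) (sum_eq_set2 u (hne b e bS eS)); clear; lia.
Qed.

(** Neither removed edge crosses the cut, while both new edges do and were absent before. *)
Lemma cross_switch G S a b c e : simple_graph G -> switchable G S a b c e ->
  [/\ (a, c) \in cross_arcs (switch G a b c e) S, (b, e) \in cross_arcs (switch G a b c e) S,
     (a, c) != (b, e) & #|cross_arcs (switch G a b c e) S| = #|cross_arcs G S| + 2].
Proof.
move=> sG /and5P[aS bS cS eS /and4P[ab ce ac be]].
have nab := simple_neq sG ab.
have hne y z : y \in S -> z \notin S -> y != z by move=> yS; apply: contraNneq => <-.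
have nn : (a, c) != (b, e) by rewrite xpair_eqE (negbTE nab).
have E : cross_arcs (switch G a b c e) S = (a, c) |: ((b, e) |: cross_arcs G S).
  apply/setP => -[u v]; rewrite !inE /= !xpair_eqE.
  case uS: (u \in S) => /=; last first.
    by rewrite !orbF; symmetry; apply/negbTE; rewrite negb_or;
       apply/andP; split; apply: contraFN uS => /andP[/eqP->].
  case vS: (v \in S) => /=.
    by rewrite !orbF; symmetry; apply/negbTE; rewrite negb_or; apply/andP; split;
       [apply: contraNN cS|apply: contraNN eS] => /andP[_ /eqP<-].
  have hu y : y \notin S -> (u == y) = false by move=> yS; apply/negbTE/hne.
  have hv y : y \in S -> (v == y) = false.
    by move=> yS; rewrite eq_sym; apply/negbTE/hne; rewrite // vS.
  rewrite adj_switch !eq_set2 !(hv a, hv b) // !(hu c, hu e) // !andbF /= !orbF.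
  by rewrite -orbA orbC -orbA.
rewrite E !setU11 !inE eqxx orbT; split=> //.
by rewrite !cardsU1 !inE (negbTE nn) /= (negbTE ac) (negbTE be) !andbF /= !add1n addn2.
Qed.

Definition switchings G S : {set (T * T) * (T * T)} :=
  [set q | switchable G S q.1.1 q.1.2 q.2.1 q.2.2].

Definition cut_layer S (x : nat) : {set {set {set T}}} := [set G in dreg | #|cross_arcs G S| == x].

(** The factors count arcs inside [S] and arcs inside its complement. For fixed [(a, b)], the arcs
    [(c, e)] with [c] adjacent to [a], or with [e] adjacent to [b], are forbidden; there are at most
    [d ^ 2] of each kind. *)
Lemma card_switchings G S : G \in dreg ->
  (d * #|S| - #|cross_arcs G S|) * (d * #|~: S| - #|cross_arcs G S| - 2 * d ^ 2)
    <= #|switchings G S|.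
Proof.
rewrite inE => /andP[sG rG].
have h1 := arcs_in_cross S rG; have h2 := arcs_in_cross (~: S) rG.
rewrite cross_arcsC in h2.
pose B1 a : {set T * T} := [set r | (r.1 \in [set c | adj G a c]) && (r.2 \in [set e | adj G r.1 e])].
pose B2 b : {set T * T} := [set r | (r.2 \in [set e | adj G b e]) && (r.1 \in [set c | adj G r.2 c])].
have cB1 a : #|B1 a| = d ^ 2.
  rewrite (card_dep_pairs [set c | adj G a c] (fun c => [set e | adj G c e])).
  by under eq_bigr do rewrite (regularP rG); rewrite sum_nat_const (regularP rG) mulnn.
have cB2 b : #|B2 b| = d ^ 2.
  have inj : injective (fun p : T * T => (p.2, p.1)) by move=> [? ?] [? ?] [-> ->].
  rewrite -(cB1 b) -(card_imset (B1 b) inj); apply: eq_card => -[c e].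
  apply/idP/imsetP => [h|[[y z] h [-> ->]]]; last by move: h; rewrite !inE.
  by exists (e, c) => //; move: h; rewrite !inE.
pose B p := arcs_in G (~: S) :\: (B1 p.1 :|: B2 p.2).
have -> : #|switchings G S| = \sum_(p in arcs_in G S) #|B p|.
  rewrite -card_dep_pairs; apply: eq_card => -[[a b] [c e]]; rewrite !inE /= /switchable.
  rewrite [adj G e c]adj_sym; case: (adj G c e); rewrite ?andbF ?andbT //.
  by rewrite negb_or; case: (a \in S) (b \in S) (c \in S) (e \in S) (adj G a b) (adj G a c) (adj G b e) => [] [] [] [] [] [] [].
have hB p : #|arcs_in G (~: S)| - 2 * d ^ 2 <= #|B p|.
  rewrite /B cardsD leq_sub2l //; apply: leq_trans (subset_leq_card (subsetIr _ _)) _.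
  by rewrite cardsU cB1 cB2; lia.
have -> : d * #|S| - #|cross_arcs G S| = #|arcs_in G S| by lia.
have -> : d * #|~: S| - #|cross_arcs G S| = #|arcs_in G (~: S)| by lia.
by rewrite -sum_nat_const; apply: leq_sum.
Qed.

Lemma card_distinct_pairs (A : {set T * T}) :
  #|[set q : (T * T) * (T * T) | [&& q.1 \in A, q.2 \in A & q.1 != q.2]]| = #|A| * #|A|.-1.
Proof.
have -> : #|[set q : (T * T) * (T * T) | [&& q.1 \in A, q.2 \in A & q.1 != q.2]]|
    = \sum_(p in A) #|A :\ p|.
  by rewrite -card_dep_pairs; apply: eq_card => q; rewrite !inE [_ == q.1]eq_sym [(_ != _) && _]andbC.
rewrite -sum_nat_const; apply: eq_bigr => p pA; have := cardsD1 p A; rewrite pA; lia.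
Qed.

(** Double counting: a graph of cut [x] with a switching goes injectively to a graph of cut [x + 2]
    with an ordered pair of distinct cut arcs. *)
Lemma cut_layer_step S (x : nat) :
  #|cut_layer S x| * ((d * #|S| - x) * (d * #|~: S| - x - 2 * d ^ 2))
    <= #|cut_layer S (x + 2)| * ((x + 2) * (x + 1)).
Proof.
pose F : {set {set {set T}} * ((T * T) * (T * T))} := [set p | (p.1 \in cut_layer S x) && (p.2 \in switchings p.1 S)].
pose Bk G' : {set (T * T) * (T * T)} :=
  [set q | [&& q.1 \in cross_arcs G' S, q.2 \in cross_arcs G' S & q.1 != q.2]].
pose B : {set {set {set T}} * ((T * T) * (T * T))} := [set p | (p.1 \in cut_layer S (x + 2)) && (p.2 \in Bk p.1)].
(* The image records the new graph and the arcs [(a, c)] and [(b, e)]; these determine the four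
   vertices, and then [switchK] recovers [G]. *)
pose phi (p : {set {set T}} * ((T * T) * (T * T))) := (switch p.1 p.2.1.1 p.2.1.2 p.2.2.1 p.2.2.2,
  ((p.2.1.1, p.2.2.1), (p.2.1.2, p.2.2.2))).
have hF : #|cut_layer S x| * ((d * #|S| - x) * (d * #|~: S| - x - 2 * d ^ 2)) <= #|F|.
  rewrite /F (card_dep_pairs _ (fun G => switchings G S)) -sum_nat_const; apply: leq_sum => G.
  by rewrite inE => /andP[GD /eqP cG]; have := card_switchings S GD; rewrite cG.
have hB : #|B| = #|cut_layer S (x + 2)| * ((x + 2) * (x + 1)).
  rewrite /B (card_dep_pairs _ Bk) -sum_nat_const; apply: eq_bigr => G.
  by rewrite inE => /andP[GD /eqP cG]; rewrite card_distinct_pairs cG addn2 addn1.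
rewrite -hB; apply: leq_trans hF _; rewrite -(card_in_imset (f := phi)).
  apply/subset_leq_card/fintype.subsetP => _ /imsetP[[G [[a b] [c e]]] GF ->].
  move: GF; rewrite !inE /= => /andP[/andP[/andP[sG rG] /eqP cG] sw].
  have GD : G \in dreg by rewrite inE sG.
  have [h1 h2 h3 h4] := cross_switch sG sw.
  rewrite (simple_switch sG sw) (regular_switch GD sw) h4 cG eqxx h3.
  by move: h1 h2; rewrite !inE /= => -> ->.
move=> [G [[a b] [c e]]] [G' [[a' b'] [c' e']]]; rewrite !inE /= => /andP[_ sw] /andP[_ sw'].
rewrite /phi /= => -[E ? ? ? ?]; subst a' b' c' e'.
by rewrite -(switchK sw) E (switchK sw').
Qed.

Lemma cut_layer_iter S (x j : nat) :
  #|cut_layer S x| * \prod_(i < j) ((d * #|S| - x - 2 * i) * (d * #|~: S| - x - 2 * d ^ 2 - 2 * i))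
    <= #|cut_layer S (x + 2 * j)| * \prod_(i < j) ((x + 2 * i + 2) * (x + 2 * i + 1)).
Proof.
elim: j => [|j IH]; first by rewrite !big_ord0 muln0 addn0.
rewrite !big_ord_recr /=; set P := \prod_(i < j) _ in IH *; set Q := \prod_(i < j) _ in IH *.
have := cut_layer_step S (x + 2 * j).
have -> : x + 2 * j + 2 = x + 2 * j.+1 by lia.
set N' := #|cut_layer S (x + 2 * j.+1)|.
have -> : (d * #|S| - (x + 2 * j)) * (d * #|~: S| - (x + 2 * j) - 2 * d ^ 2) =
  (d * #|S| - x - 2 * j) * (d * #|~: S| - x - 2 * d ^ 2 - 2 * j) by congr (_ * _); lia.
set a := (_ - _) * _ => st.
rewrite mulnA; apply: leq_trans (leq_mul IH (leqnn a)) _.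
by rewrite mulnAC (mulnC Q) mulnA leq_mul2r st orbT.
Qed.

End Switching.

(** * Binomial estimates and the proportion of graphs with a given cut size *)

Lemma bin_leq_exp2 n m : 'C(n, m) <= 2 ^ n.
Proof.
elim: n m => [|n IH] [|m] //; first by rewrite bin0 expn_gt0.
by rewrite binS expnS mul2n -addnn leq_add.
Qed.

Lemma leq_bin_mul a b c e : 'C(a, c) * 'C(b, e) <= 'C(a + b, c + e).
Proof.
rewrite -binomial.Vandermonde.
have lt : c < (c + e).+1 by lia.
rewrite (bigD1 (Ordinal lt)) //= addKn; exact: leq_addr.
Qed.

(** The bound [(n/m)^m <= 'C(n, m)]. The induction uses ['C(n+1, m+1) = (n+1)/(m+1) 'C(n, m)]
    together with [(n+1)/n <= (m+1)/m]. *)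
Lemma exp_leq_bin n m : m <= n -> n ^ m <= 'C(n, m) * m ^ m.
Proof.
elim: m n => [|m IH] [|n] // mn; rewrite ?bin0 //.
have [->|m0] := posnP m; first by rewrite bin1 !expn1 muln1.
have h := IH n mn; rewrite ltnS in mn.
have E : 'C(n.+1, m.+1) * m.+1 ^ m.+1 = n.+1 * ('C(n, m) * m.+1 ^ m).
  by rewrite expnS mulnA -[_ * m.+1]mulnC -mul_bin_diag mulnA.
rewrite E expnS leq_mul2l /=.
rewrite -(@leq_pmul2r (m ^ m)) ?expn_gt0 ?m0 // mulnAC -expnMn.
apply: leq_trans (leq_mul h (leqnn (m.+1 ^ m))); rewrite -expnMn.
by rewrite leq_exp2r //; nia.
Qed.

Lemma bin_mul_exp_leq n m y : m <= n -> 'C(n, m) * y ^ (n - m) <= y.+1 ^ n.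
Proof.
move=> mn; have lt : m < n.+1 by [].
rewrite -addn1 expnDn (bigD1 (Ordinal lt)) //= exp1n muln1; exact: leq_addr.
Qed.

Section CutLayers.
Variables (T : finType) (d : nat).
Implicit Types (G : {set {set T}}) (S : {set T}).

(** The products of [cut_layer_iter] are turned into binomials: a factor 2 is taken out of each term
    on the left, which gives falling factorials of [e1] and [e2], and the product on the right is
    [(x + 2j)! / x!]. The powers of 2 are absorbed by [(2j)! <= 4^j (j!)^2]. *)
Lemma cut_layer_bin S (x j e1 e2 : nat) :
  e1 = (d * #|S| - x)./2 -> e2 = (d * #|~: S| - x)./2 - d ^ 2 ->
  #|cut_layer d S x| * ('C(e1, j) * 'C(e2, j)) <= 'C(x + 2 * j, x) * #|cut_layer d S (x + 2 * j)|.
Proof.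
move=> E1 E2; have := cut_layer_iter d S x j.
set N := #|cut_layer d S x|; set N' := #|cut_layer d S (x + 2 * j)|.
have half2 z : (z./2).*2 <= z by rewrite -{2}(odd_double_half z) leq_addl.
have h1 : 4 ^ j * (e1 ^_ j * e2 ^_ j) <= \prod_(i < j)
    ((d * #|S| - x - 2 * i) * (d * #|~: S| - x - 2 * d ^ 2 - 2 * i)).
  rewrite !ffact_prod -big_split /= -[4 ^ j](_ : \prod_(i < j) 4 = _); last by rewrite prod_nat_const card_ord.
  rewrite -big_split /=; apply: leq_prod => i _.
  rewrite (_ : 4 * _ = (2 * (e1 - i)) * (2 * (e2 - i))); last by nia.
  apply: leq_mul; rewrite mulnBr leq_sub2r //; rewrite ?E1 ?E2 ?mulnBr ?leq_sub2r // mul2n.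
    exact: half2.
  exact: half2.
have h2 : (\prod_(i < j) ((x + 2 * i + 2) * (x + 2 * i + 1))) * x`! = (x + 2 * j)`!.
  elim: j {N' h1} => [|j IH]; first by rewrite big_ord0 mul1n addn0.
  rewrite big_ord_recr /= mulnAC IH.
  have -> : x + 2 * j.+1 = (x + 2 * j).+2 by lia.
  by rewrite addn2 addn1 2!factS [RHS]mulnA mulnC.
have h3 : (x + 2 * j)`! = 'C(x + 2 * j, x) * (x`! * (2 * j)`!).
  by rewrite -(@bin_fact (x + 2 * j) x) ?leq_addr // addKn.
have h4 : (2 * j)`! <= 4 ^ j * (j`! * j`!).
  rewrite -(@bin_fact (2 * j) j); last by lia.
  rewrite (_ : 2 * j - j = j); last by lia.
  by rewrite leq_mul // (_ : 4 = 2 ^ 2) // -expnM bin_leq_exp2.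
move=> h.
have {h} : N * (4 ^ j * (e1 ^_ j * e2 ^_ j)) * x`! <= N' * ('C(x + 2 * j, x) * (x`! * (4 ^ j * (j`! * j`!)))).
  apply: leq_trans (_ : N' * (x + 2 * j)`! <= _); last by rewrite h3 !leq_mul.
  by rewrite -h2 [X in _ <= X]mulnA leq_mul // (leq_trans _ h) // leq_mul.
have f0 : 0 < 4 ^ j * (j`! * j`!) * x`! by rewrite !muln_gt0 expn_gt0 !fact_gt0.
rewrite -!bin_ffact.
move=> hh; rewrite -(leq_pmul2r f0).
by apply: (leq_trans _ (leq_trans hh _)); apply: eq_leq; ring.
Qed.

Lemma sum_cut_layer S (x m : nat) : \sum_(j < m) #|cut_layer d S (x + 2 * j)| <= #|dreg T d|.
Proof.
have E j : #|cut_layer d S (x + 2 * j)| = \sum_(G in dreg T d) (#|cross_arcs G S| == x + 2 * j).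
  rewrite -sum1_card [RHS]big_mkcond [LHS]big_mkcond; apply: eq_bigr => G _.
  by rewrite !inE; case: (simple_graph G && regular G d) => //=; case: (_ == _).
under eq_bigr do rewrite E.
rewrite exchange_big -sum1_card; apply: leq_sum => G _.
case: (pickP (fun j : 'I_m => #|cross_arcs G S| == x + 2 * j)) => [j jP|h].
  rewrite (bigD1 j) //= (eqP jP) eqxx big1 // => i ij.
  case: eqP => // h; case/eqP: ij; apply/val_inj => /=; lia.
by rewrite big1 // => j _; rewrite h.
Qed.

(** Sum [cut_layer_bin] over [j <= e1]. Vandermonde evaluates the left side, [x + 2j <= d #|S|]
    bounds the binomials on the right, and the layers are disjoint. *)
Lemma cut_layer_bound S (x e1 e2 : nat) : x <= d * #|S| ->
  e1 = (d * #|S| - x)./2 -> e2 = (d * #|~: S| - x)./2 - d ^ 2 ->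
  #|cut_layer d S x| * 'C(e1 + e2, e1) <= 'C(d * #|S|, x) * #|dreg T d|.
Proof.
move=> xle E1 E2.
rewrite addnC -binomial.Vandermonde big_distrr /=.
apply: leq_trans (_ : \sum_(j < e1.+1) 'C(d * #|S|, x) * #|cut_layer d S (x + 2 * j)| <= _).
  apply: leq_sum => j _; rewrite [_ * 'C(e1, _)]mulnC bin_sub; last by rewrite -ltnS.
  apply: leq_trans (cut_layer_bin _ E1 E2) _; rewrite leq_mul2r; apply/orP; right.
  apply: leq_bin2l; have := ltn_ord j; rewrite ltnS.
  by have := odd_double_half (d * #|S| - x); rewrite -E1; lia.
by rewrite -big_distrr leq_mul2l sum_cut_layer orbT.
Qed.

(** The number ['C(#|T|, s)] of sets [S] is absorbed by ['C(n, s) * 'C(e1 + e2 - n, e1 - s) <= 'C(e1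
    + e2, e1)], with [n] for [#|T|]. *)
Lemma sum_cut_layer_bound (s x e1 e2 : nat) :
  e1 = (d * s - x)./2 -> e2 = (d * (#|T| - s) - x)./2 - d ^ 2 ->
  x <= d * s -> s <= e1 -> s <= #|T| -> #|T| <= e1 + e2 ->
  (\sum_(S : {set T} | #|S| == s) #|cut_layer d S x|) * 'C(e1 + e2 - #|T|, e1 - s)
    <= 'C(d * s, x) * #|dreg T d|.
Proof.
move=> E1 E2 xs se1 sn ne.
have C0 : 0 < 'C(#|T|, s) by rewrite bin_gt0.
rewrite -(leq_pmul2r C0) -mulnA big_distrl /=.
apply: leq_trans (_ : \sum_(S : {set T} | #|S| == s) 'C(d * s, x) * #|dreg T d| <= _); last first.
  rewrite sum_nat_const -(card_draws T s) mulnC leq_mul2l; apply/orP; right.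
  by rewrite subset_leq_card //; apply/fintype.subsetP => A; rewrite !inE unfold_in.
apply: leq_sum => S /eqP cS.
have := @cut_layer_bound S x e1 e2; rewrite cS.
rewrite (_ : #|~: S| = #|T| - s); last by rewrite -cS cardsCs setCK.
move=> /(_ xs E1 E2); apply: leq_trans; rewrite leq_mul2l; apply/orP; right.
rewrite mulnC; apply: leq_trans (leq_bin_mul _ _ _ _) _.
by rewrite subnKC // subnKC.
Qed.

(** Without loops the cut of a single vertex is exactly [d]. This settles [s = 1], which the
    estimates of [cut_dimensions] exclude. *)
Lemma cut_layer_set1 S (x : nat) : #|S| = 1 -> x < d -> #|cut_layer d S x| = 0.
Proof.
move=> /eqP/cards1P[v ->] xd; apply/eqP; rewrite cards_eq0; apply/eqP/setP => G.
rewrite !inE; apply/negP => /andP[/andP[sG rG] /eqP cG].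
have := arcs_in_cross [set v] rG; rewrite cG cards1.
suff -> : arcs_in G [set v] = finset.set0 by rewrite cards0; lia.
apply/setP => -[a b]; rewrite !inE /=; apply/negP => /and3P[/eqP-> /eqP-> vv].
by have := simple_neq sG vv; rewrite eqxx.
Qed.

(** Union bound over the violating set [S] and its cut size [x]; a violation means [K * x < #|S|],
    whence [x < #|S|]. *)
Lemma card_non_expander (K : nat) : 1 < d -> 0 < K ->
  #|[set G in dreg T d | ~~ edge_expander G K]| <=
  \sum_(s < #|T|.+1 | (1 < s) && (s.*2 <= #|T|)) \sum_(x < s | K * x < s)
    \sum_(S : {set T} | #|S| == s) #|cut_layer d S x|.
Proof.
move=> d1 K0.
pose bad (S : {set T}) := (1 < #|S|) && (#|S|.*2 <= #|T|).
apply: leq_trans (_ : \sum_(S | bad S) \sum_(x < #|S| | K * x < #|S|) #|cut_layer d S x| <= _).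
  apply: leq_trans (_ : #|\bigcup_(S | bad S) \bigcup_(x < #|S| | K * x < #|S|) cut_layer d S x| <= _).
    apply/subset_leq_card/fintype.subsetP => G; rewrite inE => /andP[GD].
    rewrite negb_forall => /existsP[S]; rewrite negb_imply -ltnNge => /andP[/andP[S0 S2] hS].
    have lt : #|cross_arcs G S| < #|S| by apply: leq_ltn_trans hS; rewrite leq_pmull.
    have GL : G \in cut_layer d S (#|cross_arcs G S|) by rewrite inE GD eqxx.
    apply/bigcupP; exists S; last by apply/bigcupP; exists (Ordinal lt).
    rewrite /bad S2 andbT ltn_neqAle S0 andbT; apply/negP => /eqP S1.
    have : #|cut_layer d S (#|cross_arcs G S|)| = 0 by apply: cut_layer_set1 => //; lia.
    by move/eqP; rewrite cards_eq0 => /eqP E; rewrite E inE in GL.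
  apply: leq_trans (leq_card_bigcup _ _) _; apply: leq_sum => S _; exact: leq_card_bigcup.
rewrite (partition_big (fun S : {set T} => inord #|S| : 'I_#|T|.+1) (fun s : 'I__ => (1 < s) && (s.*2 <= #|T|))) /=.
  apply: leq_sum => s hs; rewrite [X in _ <= X]exchange_big /= big_mkcond [X in _ <= X]big_mkcond /=.
  apply: leq_sum => S _; case: andP => // -[_ /eqP E].
  have -> : #|S| = s by rewrite -E inordK // ltnS -cardsT subset_leq_card ?subsetT.
  by rewrite eqxx.
by move=> S /andP[S1 S2]; rewrite inordK ?S1 // ltnS -cardsT subset_leq_card ?subsetT.
Qed.

End CutLayers.

Local Open Scope ring_scope.

(** * Random regular graphs are expanders *)

(** Equivalent to [(s/n)^s <= 1/n], the source of the polynomial decay of the failure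
    probability. *)
Lemma leq_mul_exp_half (s n : nat) : (0 < s)%N -> (s.*2 <= n)%N -> (n * s ^ s <= n ^ s)%N.
Proof.
case: s => // s _ h; rewrite [(n ^ _)%N]expnS leq_mul2l; apply/orP; right.
apply: leq_trans (_ : ((s.+1).*2 ^ s)%N <= _)%N; last by case: s h => // s h; rewrite leq_exp2r.
rewrite -mul2n expnMn expnS leq_mul2r; apply/orP; right.
exact: ltn_expl.
Qed.

(** Up to lower-order terms, [e1 - s] is [(d - 2) s / 2] and [e1 + e2 - n] is [(d - 2) n / 2], which
    is where [d >= 3] enters. The factor [5/4] in their ratio absorbs the rounding, [x] and
    [d ^ 2]. *)
Lemma cut_dimensions (d n s x : nat) :
  (3 <= d -> 100 * d ^ 2 <= n -> 1 < s -> s.*2 <= n -> 20 * x < s ->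
   let e1 := (d * s - x)./2 in let e2 := (d * (n - s) - x)./2 - d ^ 2 in
   [/\ x <= d * s /\ s <= e1, n <= e1 + e2, s <= 5 * (e1 - s), e1 - s <= e1 + e2 - n &
     4 * n * (e1 - s) <= 5 * s * (e1 + e2 - n)])%N.
Proof.
move=> d3 nd s1 sn xs e1 e2.
have H1 := odd_double_half (d * s - x); have H2 := odd_double_half (d * (n - s) - x).
have {H1} [H1 H1'] : (e1.*2 <= d * s - x)%N /\ (d * s - x <= e1.*2 + 1)%N by rewrite /e1; lia.
have {}H2 : (d * (n - s) - x <= (e2 + d ^ 2).*2 + 1)%N by rewrite /e2; lia.
have h1 : (3 * s <= d * s)%N by rewrite leq_mul2r d3 orbT.
have h2 : (d * s + d * (n - s) = d * n)%N by rewrite -mulnDr subnKC //; lia.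
have h3 : (3 * n <= d * n)%N by rewrite leq_mul2r d3 orbT.
have dd : (9 <= d ^ 2)%N by rewrite -[9%N]/(3 ^ 2)%N leq_exp2r.
have M2 : (d * n - 2 * n - 2 * x - 2 - 2 * d ^ 2 <= (e1 + e2 - n).*2)%N by lia.
have big : (4 * (d * n - 2 * n) <= 5 * (d * n - 2 * n - 2 * x - 2 - 2 * d ^ 2))%N by lia.
have t2 : ((e1 - s).*2 <= d * s - 2 * s)%N by lia.
have key : (4 * n * (e1 - s) <= 5 * s * (e1 + e2 - n))%N.
  have : (4 * n * (e1 - s).*2 <= 5 * s * (e1 + e2 - n).*2)%N.
    apply: leq_trans (_ : 4 * n * (d * s - 2 * s) <= _)%N; first by rewrite leq_mul2l t2 orbT.
    apply: leq_trans (_ : 5 * s * (d * n - 2 * n - 2 * x - 2 - 2 * d ^ 2) <= _)%N; last by rewrite leq_mul2l M2 orbT.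
    have -> : (4 * n * (d * s - 2 * s) = s * (4 * (d * n - 2 * n)))%N by rewrite -!mulnBl; ring.
    by apply: leq_trans (leq_mul (leqnn s) big) _; rewrite mulnA [(s * 5)%N]mulnC.
  lia.
split=> //; try lia.
have s0 : (0 < 5 * s)%N by lia.
rewrite -(leq_pmul2l s0); apply: leq_trans key; rewrite leq_mul2r; lia.
Qed.

Section ExpanderProbability.
Variable R : realType.

Lemma bernoulli_ineq (a : R) (n : nat) : 0 <= a -> 1 + n%:R * a <= (1 + a) ^+ n.
Proof.
move=> a0; elim: n => [|n IH]; first by rewrite mul0r addr0.
have p : 0 <= n%:R * a by rewrite mulr_ge0.
rewrite exprS; apply: le_trans (ler_wpM2l _ IH); last by lra.
by rewrite -natr1; nra.
Qed.

(** From ['C(ds, x) <= (1 + 1/Y)^(ds) Y^x]: a large [Y] controls the first factor, and [K], chosen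
    after [Y], the second. Each has tenth power at most [(11/10)^s], and [(11/10)^2 <= 5/4]. *)
Lemma bin_small_cut (d : nat) : (0 < d)%N -> exists K : nat, (20 <= K)%N /\
  forall s x : nat, (K * x < s)%N -> ('C(d * s, x)%:R ^+ 10 <= (5 / 4) ^+ s :> R).
Proof.
move=> d0; pose Y := (200 * d)%N.
have Y0 : 0 < Y%:R :> R by rewrite ltr0n /Y; lia.
(* By Bernoulli [(11/10)^K >= 1 + K/10 >= Y^10]; the summand 20 provides [20 * x < s] for
   [cut_dimensions]. *)
exists (20 + 10 * Y ^ 10)%N; split; first by lia.
set K := (20 + _)%N => s x xs.
have YK : Y%:R ^+ 10 <= (11 / 10) ^+ K :> R.
  have -> : 11 / 10 = 1 + 1 / 10 :> R by lra.
  apply: le_trans (bernoulli_ineq _ _); last by lra.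
  rewrite -natrX /K natrD natrM; set u := (_ ^ _)%N%:R : R.
  have : 0 <= u by []. 
  lra.
have xds : (x <= d * s)%N by rewrite /K in xs; nia.
have h1 : 'C(d * s, x)%:R <= (1 + Y%:R^-1) ^+ (d * s) * Y%:R ^+ x :> R.
  rewrite -(ler_pM2r (exprn_gt0 (d * s - x) Y0)) -mulrA -exprD subnKC //.
  rewrite -exprMn mulrDl mul1r mulVf ?gt_eqF // -!natrX -natrM natr1 -natrX ler_nat.
  exact: bin_mul_exp_leq.
(* With [Y = 200 d] the left side is at most [exp(1/20) <= 20/19]. *)
have h2 : (1 + Y%:R^-1) ^+ (10 * d) <= 11 / 10 :> R.
  apply: le_trans (_ : expR (1 / 20) <= _).
    have -> : 1 / 20 = (10 * d)%:R * Y%:R^-1 :> R.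
      rewrite /Y !natrM; field; rewrite pnatr_eq0; lia.
    by rewrite expRM_natl; apply: lerXn2r (expR_ge1Dx _); rewrite nnegrE ?expR_ge0 // addr_ge0 // invr_ge0 ltW.
  rewrite -[1 / 20]opprK expRN.
  have h := expR_ge1Dx (- (1 / 20) : R).
  by rewrite -div1r ler_pdivrMr ?expR_gt0 //; lra.
apply: le_trans (_ : (11 / 10 : R) ^+ s * (11 / 10) ^+ s <= _); last first.
  by rewrite -exprMn; apply: lerXn2r; rewrite ?nnegrE; lra.
apply: le_trans (_ : ((1 + Y%:R^-1) ^+ (d * s) * Y%:R ^+ x) ^+ 10 <= _).
  by apply: lerXn2r h1; rewrite nnegrE // ?ler0n // mulr_ge0 // exprn_ge0 // ?addr_ge0 // ?invr_ge0 ltW.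
rewrite exprMn; apply: ler_pM; rewrite ?exprn_ge0 // ?addr_ge0 ?invr_ge0 //.
  rewrite -exprM (_ : d * s * 10 = 10 * d * s)%N; last by lia.
  by rewrite exprM; apply: lerXn2r => //; rewrite nnegrE ?exprn_ge0 ?addr_ge0 ?invr_ge0 //; lra.
rewrite -exprM mulnC exprM; apply: le_trans (_ : ((11 / 10) ^+ K) ^+ x <= _).
  by apply: lerXn2r => //; rewrite nnegrE exprn_ge0 //; lra.
by rewrite -exprM; apply: ler_weXn2l; [lra | exact: ltnW].
Qed.

Lemma le_powR_inv (a b : R) (n : nat) : (0 < n)%N -> 0 <= a -> a ^+ n <= b -> a <= b `^ (n%:R^-1).
Proof.
move=> n0 a0 ab; have an : 0 <= a ^+ n by rewrite exprn_ge0.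
have -> : a = (a ^+ n) `^ n%:R^-1.
  by rewrite -powR_mulrn // -powRrM divff ?powRr1 // pnatr_eq0 -lt0n.
by apply: ge0_ler_powR => //; rewrite ?invr_ge0 // nnegrE // (le_trans an).
Qed.

Lemma sum_arith_geom (r : R) (n : nat) : 0 <= r < 1 ->
  \sum_(s < n) s.+1%:R * r ^+ s <= (1 - r) ^- 2.
Proof.
move=> /andP[r0 r1]; have e0 : 0 < 1 - r by lra.
have E : (\sum_(s < n) s.+1%:R * r ^+ s) * (1 - r) ^+ 2 = 1 - r ^+ n * (1 + n%:R * (1 - r)).
  elim: n => [|n IH]; first by rewrite big_ord0 expr0; ring.
  by rewrite big_ord_recr /= mulrDl IH [r ^+ n.+1]exprS -[n.+1%:R]natr1; ring.
rewrite -[leRHS]mul1r ler_pdivlMr ?exprn_gt0 // E.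
by rewrite lerBlDr lerDl mulr_ge0 ?exprn_ge0 // addr_ge0 // mulr_ge0 // ltW.
Qed.

(** Tenth powers are compared. With [z = 5s/(4n)] the inverse binomial is at most [z^t], and
    [10 t >= 2 s] leaves [(z^2)^s]. As [s/n <= 1/2], [z^2 <= (25/32)(s/n)]; finally
    [(5/4)(25/32) = 125/128 < 1] and [(s/n)^s <= 1/n]. *)
Lemma cut_ratio_bound (d n s x e1 e2 K : nat) : (20 <= K)%N ->
  (forall s x : nat, (K * x < s)%N -> ('C(d * s, x)%:R ^+ 10 <= (5 / 4) ^+ s :> R)) ->
  (3 <= d)%N -> (100 * d ^ 2 <= n)%N -> (1 < s)%N -> (s.*2 <= n)%N -> (K * x < s)%N ->
  e1 = ((d * s - x)./2)%N -> e2 = ((d * (n - s) - x)./2 - d ^ 2)%N ->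
  'C(d * s, x)%:R / 'C(e1 + e2 - n, e1 - s)%:R <=
    ((125 / 128) `^ (10%:R^-1)) ^+ s * (n%:R `^ 10%:R^-1)^-1 :> R.
Proof.
move=> K20 hK d3 nd s1 sn xs E1 E2.
have x20 : (20 * x < s)%N by apply: leq_ltn_trans xs; rewrite leq_mul2r K20 orbT.
have [[_ se1] ne12 st tM key] := cut_dimensions d3 nd s1 sn x20.
rewrite -E1 -E2 in se1 ne12 st tM key.
set M := (e1 + e2 - n)%N in tM key *; set t := (e1 - s)%N in st tM key *.
clearbody M t; clear E1 E2 se1 ne12.
have n0 : 0 < n%:R :> R by rewrite ltr0n; lia.
have t0 : 0 < t%:R :> R by rewrite ltr0n; lia.
have M0 : 0 < M%:R :> R by rewrite ltr0n; lia.
have C0 : 0 < 'C(M, t)%:R :> R by rewrite ltr0n bin_gt0.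
have -> : ((125 / 128) `^ (10%:R^-1)) ^+ s * (n%:R `^ 10%:R^-1)^-1 =
    ((125 / 128) ^+ s / n%:R) `^ 10%:R^-1 :> R.
  have p0 : 0 <= 125 / 128 :> R by lra.
  rewrite (powRM _ (exprn_ge0 _ p0)) ?invr_ge0 //.
  congr (_ * _); first by rewrite -powR_mulrn ?powR_ge0 // -powRrM [10%:R^-1 * _]mulrC powRrM powR_mulrn.
  by rewrite -[n%:R^-1](powR_inv1 (ler0n R n)) -powRrM mulN1r powRN.
apply: le_powR_inv => //.
rewrite expr_div_n.
pose z : R := (5 * s%:R) / (4 * n%:R).
have z0 : 0 < z by rewrite divr_gt0 ?mulr_gt0 // ltr0n; lia.
have sn' : s%:R / n%:R <= 1 / 2 :> R.
  by rewrite ler_pdivrMr // -(ler_pM2l (_ : 0 < 2 :> R)) // mulrA mulrCA mulfV // mulr1 mul1r -natrM ler_nat; lia.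
have zE : z = 5 / 4 * (s%:R / n%:R) by rewrite /z; field; rewrite gt_eqF.
have z1 : z <= 1 by rewrite zE; lra.
have tz : t%:R / M%:R <= z.
  rewrite ler_pdivrMr // /z mulrAC ler_pdivlMr ?mulr_gt0 //.
  rewrite mulrC -!natrM ler_nat.
  by have := key; lia.
have hC : 'C(M, t)%:R^-1 <= z ^+ t.
  apply: le_trans (_ : (t%:R / M%:R) ^+ t <= _); last first.
    by apply: lerXn2r => //; rewrite nnegrE ?ltW // divr_gt0.
  rewrite expr_div_n ler_pdivlMr ?exprn_gt0 // mulrC ler_pdivrMr //.
  by rewrite -!natrX -natrM ler_nat mulnC exp_leq_bin.
have hC5 : ('C(M, t)%:R^-1) ^+ 10 <= (z ^+ 2) ^+ s.
  apply: le_trans (_ : (z ^+ t) ^+ 10 <= _).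
    by apply: lerXn2r hC; rewrite nnegrE ?invr_ge0 ?exprn_ge0 // ltW.
  by rewrite -!exprM; apply: ler_wiXn2l z1 _ _ _; [exact: ltW | clear -st; lia].
have z2 : z ^+ 2 <= 25 / 32 * (s%:R / n%:R).
  have : 0 <= s%:R / n%:R :> R by rewrite divr_ge0.
  by rewrite zE; nra.
have sn2 : (s%:R / n%:R) ^+ s <= n%:R^-1 :> R.
  rewrite expr_div_n ler_pdivrMr ?exprn_gt0 // mulrC ler_pdivlMr // mulrC.
  by rewrite -!natrX -natrM ler_nat (leq_mul_exp_half (ltnW s1) sn).
apply: le_trans (_ : (5 / 4) ^+ s * (z ^+ 2) ^+ s <= _).
  by apply: ler_pM; rewrite ?exprn_ge0 ?invr_ge0 ?exprn_ge0 //; [exact: hK | rewrite -exprVn].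
apply: le_trans (_ : (5 / 4) ^+ s * (25 / 32 * (s%:R / n%:R)) ^+ s <= _).
  rewrite ler_wpM2l ?exprn_ge0 //.
  by apply: lerXn2r => //; rewrite nnegrE ?exprn_ge0 ?mulr_ge0 ?divr_ge0 ?(ltW z0).
move: sn2; set q := s%:R / n%:R => sn2.
have -> : (5 / 4) ^+ s * (25 / 32 * q) ^+ s = (125 / 128) ^+ s * q ^+ s :> R.
  by rewrite -!exprMn; congr (_ ^+ _); field.
by rewrite ler_wpM2l ?exprn_ge0.
Qed.

Theorem random_regular_expander (d : nat) : (3 <= d)%N ->
  exists (K n0 : nat) (B : R), [/\ (0 < K)%N, 0 < B &
  forall T : finType, (n0 <= #|T|)%N ->
    #|[set G in dreg T d | ~~ edge_expander G K]|%:R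
      <= B / #|T|%:R `^ 10%:R^-1 * #|dreg T d|%:R].
Proof.
move=> d3; have d0 : (0 < d)%N by lia.
have [K [K20 hK]] := bin_small_cut d0.
pose r : R := (125 / 128) `^ 10%:R^-1.
have r0 : 0 <= r by exact: powR_ge0.
have r1 : r < 1.
  have <- : 1 `^ (10%:R^-1) = 1 :> R by rewrite powR1.
  by rewrite /r; apply: gt0_ltr_powR; rewrite ?nnegrE ?invr_gt0 //; lra.
exists K, (100 * d ^ 2)%N, ((1 - r) ^- 2); split; first by lia.
  by rewrite invr_gt0 exprn_gt0 //; lra.
move=> T nT; set n := #|T| in nT *; set q := n%:R `^ _.
set D := #|dreg T d|.
have q0 : 0 <= q by exact: powR_ge0.
(* For each [s] there are at most [s] values of [x], each contributing at most
   [r ^+ s * (D / q)]. *)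
apply: le_trans (_ : \sum_(s < n.+1) s.+1%:R * r ^+ s * (D%:R / q) <= _); last first.
  rewrite -big_distrl /= mulrAC -mulrA ler_wpM2r ?divr_ge0 //.
  by apply: sum_arith_geom; rewrite r0.
apply: le_trans (_ : (\sum_(s < n.+1 | (1 < s) && (s.*2 <= n)) \sum_(x < s | K * x < s)
    \sum_(S : {set T} | #|S| == s) #|cut_layer d S x|)%N%:R <= _).
  by rewrite ler_nat; apply: card_non_expander; lia.
rewrite natr_sum big_mkcond /=; apply: ler_sum => s _.
case: andP => [[s1 sn]|_]; last by rewrite mulr_ge0 ?divr_ge0 // mulr_ge0 ?exprn_ge0.
apply: le_trans (_ : \sum_(x < s) r ^+ s * (D%:R / q) <= _); last first.
  rewrite sumr_const card_ord -[_ *+ s]mulr_natl mulrA; apply: ler_wpM2r; first exact: divr_ge0.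
  by apply: ler_wpM2r; rewrite ?exprn_ge0 // ler_nat.
rewrite natr_sum big_mkcond /=; apply: ler_sum => x _.
case: ifP => [xs|_]; last by rewrite mulr_ge0 ?exprn_ge0 ?divr_ge0.
have x20 : (20 * x < s)%N by apply: leq_ltn_trans xs; rewrite leq_mul2r K20 orbT.
have [[xds se1] ne12 st tM key] := cut_dimensions d3 nT s1 sn x20.
have sn1 : (s <= #|T|)%N by rewrite -/n; lia.
have h := sum_cut_layer_bound erefl erefl xds se1 sn1 ne12.
have := cut_ratio_bound K20 hK d3 nT s1 sn xs erefl erefl.
rewrite -/n -/q -/r in h *.
set C := 'C(_, _ - s)%N in h *; set N := (\sum_(S : {set T} | _) _)%N in h *.
have C0 : 0 < C%:R :> R by rewrite ltr0n bin_gt0.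
move=> h2; rewrite mulrCA mulrC; apply: le_trans (ler_wpM2r (ler0n _ D) h2).
by rewrite mulrAC ler_pdivlMr // -!natrM ler_nat.
Qed.

End ExpanderProbability.

Local Open Scope nat_scope.

(** * Embedding into a box *)

Section BoxDistance.
Variables (I : finType) (H : nat).
Implicit Types f g h : {ffun I -> 'I_H.+1}.

Definition box_dist f g : nat := \max_i maxn (f i - g i) (g i - f i).

Lemma box_dist_geq f g i : f i - g i <= box_dist f g.
Proof. by apply: leq_trans (leq_bigmax i); rewrite leq_maxl. Qed.

Lemma box_dist_leqP f g m :
  reflect (forall i, f i <= g i + m /\ g i <= f i + m) (box_dist f g <= m).
Proof.
apply: (iffP (bigmax_leqP _ _ _)) => h i; have := h i; rewrite geq_max; first by move=> /(_ isT); lia.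
by lia.
Qed.

Lemma box_distxx f : box_dist f f = 0.
Proof. by apply/eqP; rewrite -leqn0; apply/box_dist_leqP => i; lia. Qed.

Lemma box_dist_sym f g : box_dist f g = box_dist g f.
Proof. by apply: eq_bigr => i _; rewrite maxnC. Qed.

Lemma box_dist_eq0 f g : box_dist f g = 0 -> f = g.
Proof.
move=> e; apply/ffunP => i; apply/val_inj => /=.
have /box_dist_leqP/(_ i) : box_dist f g <= 0 by rewrite e.
lia.
Qed.

Lemma box_dist_triangle g f h : box_dist f h <= box_dist f g + box_dist g h.
Proof.
apply/box_dist_leqP => i.
have /box_dist_leqP/(_ i) := leqnn (box_dist f g).
have /box_dist_leqP/(_ i) := leqnn (box_dist g h).
lia.
Qed.

Lemma box_dist_attained f g : 0 < box_dist f g -> exists i, box_dist f g <= f i - g i \/ box_dist f g <= g i - f i.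
Proof.
move=> h; have I0 : 0 < #|I|.
  by rewrite lt0n; apply: contraTneq h => /card0_eq I0; rewrite /box_dist big1 // => i; have := I0 i.
have [i e] := @bigop.eq_bigmax I (fun i => maxn (f i - g i) (g i - f i)) I0.
by exists i; rewrite /box_dist e; case: (leqP (f i - g i) (g i - f i)) => _; [right|left].
Qed.

End BoxDistance.

Lemma card_setT_finType (X : finType) : ([set: X] #= `I_#|X|)%classic%card.
Proof.
apply/card_set_bijP; exists (fun x : X => enum_rank x : nat); split.
- by move=> x _ /=; exact: ltn_ord.
- by move=> x y _ _ /val_inj/enum_rank_inj.
- by move=> k /= kX; exists (enum_val (Ordinal kX)); rewrite //= enum_valK.
Qed.

(** The field [R] is a parameter so that the type fixes where its metric takes values. *)
Definition box (R : realType) (I : finType) (H : nat) : Type := {ffun I -> 'I_H.+1}.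

HB.instance Definition _ R I H := Finite.copy (box R I H) {ffun I -> 'I_H.+1}.

Section BoxMetric.
Variables (R : realType) (I : finType) (H : nat).
Local Open Scope ring_scope.

Let bdist (f g : box R I H) : R := (box_dist f g)%:R.

Let bdistxx f : bdist f f = 0.
Proof. by rewrite /bdist box_distxx. Qed.

Let bdist_positivity f g : bdist f g = 0 -> f = g.
Proof. by move/eqP; rewrite pnatr_eq0 => /eqP/box_dist_eq0. Qed.

Let bdist_sym f g : bdist f g = bdist g f.
Proof. by rewrite /bdist box_dist_sym. Qed.

Let bdist_triangle g f h : bdist f h <= bdist f g + bdist g h.
Proof. by rewrite -natrD ler_nat box_dist_triangle. Qed.

HB.instance Definition _ := isMetric.Build R (box R I H)
  bdistxx bdist_positivity bdist_sym bdist_triangle.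

Lemma box_mdistE (f g : box R I H) : mdist f g = (box_dist f g)%:R.
Proof. by []. Qed.

Lemma card_box : ([set: box R I H] #= `I_(H.+1 ^ #|I|))%classic%card.
Proof.
have -> : (H.+1 ^ #|I|)%N = #|{ffun I -> 'I_H.+1}| by rewrite card_ffun card_ord.
exact: card_setT_finType.
Qed.

End BoxMetric.

Section SetDistance.
Variables (T : finType) (G : {set {set T}}) (H : nat).
Hypothesis conn : graph_connected G.

(** The default [H] serves the empty [A] and caps the value, so that it fits in ['I_H.+1]. *)
Definition set_dist (A : {set T}) u : nat := \big[minn/H]_(a in A) gdist G a u.

Lemma set_dist_default A u : set_dist A u <= H.
Proof. exact: bigminn_leq_id. Qed.

Lemma set_dist_leq (A : {set T}) a u : a \in A -> set_dist A u <= gdist G a u.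
Proof. exact: bigminn_leq. Qed.

Lemma set_dist_lipschitz A u v : set_dist A u <= set_dist A v + gdist G u v.
Proof.
case: (bigminn_attained (index_enum T) H (mem A) (fun a => gdist G a v)) => [e|[a aA e]].
  by rewrite {2}/set_dist e; apply: leq_trans (set_dist_default _ _) (leq_addr _ _).
rewrite {2}/set_dist e (gdist_sym conn u).
exact: leq_trans (set_dist_leq _ aA) (gdist_triangle conn _ _ _).
Qed.

Definition separates (A : {set T}) (p : {set T} * {set T}) : bool :=
  (A :&: p.1 != finset.set0) && (A :&: p.2 == finset.set0).

(* Matousek's argument: balls centred at u and v alternately, the i-th of radius
   i D / (2q-1) with D = dist(u,v). Consecutive balls are disjoint once the larger is
   opened, so a set meeting the i-th and avoiding the (i+1)-st separates u from v by
   at least D / (2q-1). *)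
Definition matousek_center u v i : T := if odd i then v else u.

Definition matousek_ball q u v i : {set T} :=
  [set w | (q.*2.-1 * gdist G (matousek_center u v i) w <= i * gdist G u v)].

Definition matousek_open_ball q u v i : {set T} :=
  [set w | (q.*2.-1 * gdist G (matousek_center u v i) w < i * gdist G u v)].

Lemma matousek_disjoint q u v i : i < q ->
  matousek_ball q u v i :&: matousek_open_ball q u v i.+1 = finset.set0.
Proof.
move=> iq; apply/setP => w; rewrite !inE; apply/negP => /andP[h1 h2].
have t : gdist G u v <= gdist G (matousek_center u v i) w + gdist G (matousek_center u v i.+1) w.
  rewrite /matousek_center /=; case: odd => /=; last by rewrite (gdist_sym conn v) gdist_triangle.
  by rewrite addnC (gdist_sym conn v) gdist_triangle.
(* This would force [2q - 1 < 2i + 1], against [i < q]. *)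
have : q.*2.-1 * gdist G u v < (i + i.+1) * gdist G u v.
  by apply: leq_ltn_trans (leq_mul (leqnn _) t) _; rewrite mulnDr mulnDl -addnS leq_add.
by rewrite ltn_mul2r; lia.
Qed.

Lemma matousek_separated q u v i A : i < q -> gdist G u v <= H ->
  separates A (matousek_ball q u v i, matousek_open_ball q u v i.+1) ->
  gdist G u v <= q.*2.-1 * maxn (set_dist A u - set_dist A v) (set_dist A v - set_dist A u).
Proof.
move=> iq dH /andP[/set0Pn[a] /setIP[aA]]; rewrite inE => ha /eqP disj.
set c := matousek_center u v i in ha.
have h1 : q.*2.-1 * set_dist A c <= i * gdist G u v.
  by apply: leq_trans ha; rewrite leq_mul // (gdist_sym conn) set_dist_leq.
set c' := matousek_center u v i.+1.
have h2 : i.+1 * gdist G u v <= q.*2.-1 * set_dist A c'.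
  case: (bigminn_attained (index_enum T) H (mem A) (fun a => gdist G a c')) => [e|[b bA e]]; rewrite /set_dist e.
    by rewrite leq_mul //; lia.
  rewrite leqNgt; apply/negP => h.
  have : b \in A :&: matousek_open_ball q u v i.+1.
    by apply/setIP; split=> //; rewrite inE (gdist_sym conn).
  by rewrite disj inE.
have : gdist G u v <= q.*2.-1 * (set_dist A c' - set_dist A c).
  rewrite mulnBr; move: h1 h2; rewrite mulSn; lia.
rewrite /c /c' /matousek_center /=; case: odd => /= h; apply: leq_trans h _; rewrite leq_mul2l; lia.
Qed.

Lemma matousek_ball_center q u v i : matousek_center u v i \in matousek_ball q u v i.
Proof. by rewrite inE gdistuu muln0. Qed.

Lemma matousek_open_ball_sub q u v i : matousek_open_ball q u v i \subset matousek_ball q u v i.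
Proof. by apply/fintype.subsetP => w; rewrite !inE => /ltnW. Qed.

Local Open Scope ring_scope.

(** If each of the [q] steps multiplied the ball size by more than [Y], the last ball would exceed
    [Y ^+ q >= #|T|]. Only cardinalities matter, so the alternating centres do no harm. *)
Lemma matousek_growth (R : realType) (Y : R) q u v : (0 < q)%N -> 0 <= Y -> #|T|%:R <= Y ^+ q ->
  exists2 i : nat, (i < q)%N & #|matousek_ball q u v i.+1|%:R <= Y * #|matousek_ball q u v i|%:R.
Proof.
move=> q0 Y0 hq.
case: (pickP (fun i : 'I_q => #|matousek_ball q u v i.+1|%:R <= Y * #|matousek_ball q u v i|%:R)) => [i hi|h].
  by exists i.
have b0 : 1 <= #|matousek_ball q u v 0|%:R :> R.
  by rewrite (ler_nat _ 1) card_gt0; apply/set0Pn; exists (matousek_center u v 0); exact: matousek_ball_center.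
have grow j : (j < q)%N -> Y ^+ j.+1 < #|matousek_ball q u v j.+1|%:R.
  have st k : (k < q)%N -> Y * #|matousek_ball q u v k|%:R < #|matousek_ball q u v k.+1|%:R.
    by move=> kq; rewrite ltNge; apply/negbT; exact: (h (Ordinal kq)).
  elim: j => [|j IH] jq; apply: le_lt_trans (st _ jq); first by rewrite expr1 ler_peMr.
  by rewrite exprS ler_wpM2l // ltW // IH // ltnW.
case: q q0 hq grow {h b0} => // q _ hq /(_ q (leqnn _)); rewrite ltNge => /negP[].
by apply: le_trans hq; rewrite ler_nat max_card.
Qed.

End SetDistance.

Local Open Scope ring_scope.

(** * Greedy covering and random zero sets: derandomizing the choice of the coordinates *)

Section GreedyCovering.
Variables (R : realType) (P F : finType) (good : P -> F -> bool) (S : {set P}) (theta : R).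
Hypotheses (F0 : (0 < #|F|)%N) (theta1 : theta <= 1).
Hypothesis dense : forall p, p \in S -> theta * #|F|%:R <= #|[set f | good p f]|%:R.

(** By averaging over [F], some [f] is good for a proportion [theta] of the points still uncovered;
    adding it shrinks them by [1 - theta]. *)
Lemma greedy_covering r : exists2 s : seq F, size s = r &
  #|[set p in S | ~~ has (good p) s]|%:R <= (1 - theta) ^+ r * #|S|%:R.
Proof.
elim: r => [|r [s sr hs]].
  exists [::] => //; rewrite expr0 mul1r ler_nat subset_leq_card //.
  by apply/fintype.subsetP => p; rewrite inE => /andP[].
set U := [set p in S | _] in hs.
have [f hf] : exists f, theta * #|U|%:R <= #|[set p in U | good p f]|%:R.
  apply: contrapT => /forallNP h.
  have : \sum_(f : F) #|[set p in U | good p f]|%:R < \sum_(f : F) theta * #|U|%:R.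
    have [f0 _] : exists f0, f0 \in F by apply/card_gt0P.
    rewrite (bigD1 f0) //= [ltRHS](bigD1 f0) //= ltr_leD //; first by rewrite ltNge; apply/negP/h.
    by apply: ler_sum => f _; rewrite ltW // ltNge; apply/negP/h.
  rewrite sumr_const -[_ *+ _]mulr_natr mulrAC.
  have E : \sum_(f : F) #|[set p in U | good p f]|%:R = \sum_(p in U) #|[set f | good p f]|%:R :> R.
    rewrite -!natr_sum; congr _%:R.
    transitivity (\sum_(f : F) \sum_(p in U) (good p f : nat))%N.
      apply: eq_bigr => f _; rewrite -sum1_card big_mkcond [RHS]big_mkcond; apply: eq_bigr => p _.
      by rewrite inE; case: (p \in U) => //=; case: (good p f).
    rewrite exchange_big; apply: eq_bigr => p _; rewrite -sum1_card [RHS]big_mkcond.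
    by apply: eq_bigr => f _; rewrite inE; case: (good p f).
  rewrite E ltNge => /negP; apply.
  rewrite mulr_natr -sumr_const; apply: ler_sum => p; rewrite inE => /andP[pS _]; exact: dense.
exists (f :: s); first by rewrite /= sr.
have -> : [set p in S | ~~ has (good p) (f :: s)] = U :\: [set p in U | good p f].
  apply/setP => p; rewrite !inE /= negb_or; by case: (p \in S) (has _ _) (good p f) => [] [] [].
rewrite cardsD (finset.setIidPr _) ?natrB; last 2 first.
- by apply/subset_leq_card/fintype.subsetP => p; rewrite inE => /andP[].
- by apply/fintype.subsetP => p; rewrite inE => /andP[].
rewrite exprS -mulrA; apply: le_trans (ler_wpM2l _ hs); last by rewrite subr_ge0.
by rewrite mulrBl mul1r lerB.
Qed.

Lemma full_covering r : (1 - theta) ^+ r * #|S|%:R < 1 ->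
  exists2 s : seq F, size s = r & forall p, p \in S -> has (good p) s.
Proof.
move=> h; have [s sr hs] := greedy_covering r; exists s => // p pS; apply/negPn/negP => hp.
have := le_lt_trans hs h; rewrite (ltr_nat _ _ 1) ltnS leqn0 cards_eq0 => /eqP /setP/(_ p).
by rewrite !inE pS hp.
Qed.

End GreedyCovering.

Section RandomZeroSet.
Variables (T : finType) (Q : nat).
Implicit Types (X B O : {set T}) (f : {ffun T -> 'I_Q.+1}).

(* Under the uniform labelling f this is a random subset of density 1/(Q+1). *)
Definition zeros f : {set T} := [set x | f x == ord0].

Lemma card_zeros_avoid X :
  #|[set f | zeros f :&: X == finset.set0]| = (Q ^ #|X| * Q.+1 ^ (#|T| - #|X|))%N.
Proof.
pose Fm x : pred 'I_Q.+1 := if x \in X then predC1 ord0 else predT.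
transitivity #|(family Fm : simpl_pred {ffun T -> 'I_Q.+1})|.
  apply: eq_card => f; rewrite inE; apply/eqP/familyP => [h x|h].
    rewrite /Fm; case: ifP => // xX; rewrite inE; apply/negP => fx.
    by have := in_set0 x; rewrite -h !inE fx xX.
  by apply/setP => x; rewrite !inE; apply/negP => /andP[fx xX]; have := h x; rewrite /Fm xX inE fx.
rewrite card_family foldrE big_map big_enum /=.
rewrite (bigID (mem X)) /=.
rewrite (eq_bigr (fun _ => Q)) => [|x xX]; last by rewrite /Fm xX cardC1 card_ord.
rewrite [X in (_ * X)%N](eq_bigr (fun _ => Q.+1)) => [|x xX]; last by rewrite /Fm (negbTE xX) card_ord.
rewrite !prod_nat_const; congr (_ * _ ^ _)%N.
by rewrite -(cardC (mem X)) addKn; apply: eq_card => x; rewrite !inE.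
Qed.

Variable R : realType.

(** Avoiding [O] and meeting [B] are independent events for disjoint [B] and [O]; each label is
    nonzero with probability [Q/(Q+1)]. *)
Lemma card_separates B O : B :&: O = finset.set0 ->
  #|[set f | separates (zeros f) (B, O)]|%:R =
  (Q%:R / Q.+1%:R) ^+ #|O| * (1 - (Q%:R / Q.+1%:R) ^+ #|B|) * #|{: {ffun T -> 'I_Q.+1}}|%:R :> R.
Proof.
move=> BO.
have -> : [set f | separates (zeros f) (B, O)] =
    [set f | zeros f :&: O == finset.set0] :\: [set f | zeros f :&: (O :|: B) == finset.set0].
  apply/setP => f; rewrite !inE /separates /= setIUr setU_eq0 negb_and.
  by case: (_ :&: O == _); rewrite ?andbF ?orbF ?andbT.
have sub : [set f | zeros f :&: (O :|: B) == finset.set0] \subset [set f | zeros f :&: O == finset.set0].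
  by apply/fintype.subsetP => f; rewrite !inE setIUr setU_eq0 => /andP[].
have cU : #|O :|: B| = (#|O| + #|B|)%N by rewrite cardsU setIC BO cards0 subn0.
have le1 : (#|O| + #|B| <= #|T|)%N by rewrite -cU -cardsT subset_leq_card ?subsetT.
rewrite cardsD (finset.setIidPr sub) natrB ?subset_leq_card // !card_zeros_avoid cU.
rewrite card_ffun card_ord !natrM !natrX.
have q0 : Q.+1%:R != 0 :> R by rewrite pnatr_eq0.
have -> : (#|T| = (#|O| + #|B|) + (#|T| - (#|O| + #|B|)))%N by rewrite subnKC.
rewrite addKn; set k := (#|T| - _)%N.
rewrite (_ : #|O| + #|B| + k - #|O| = #|B| + k)%N; last by rewrite -addnA addKn.
rewrite !expr_div_n !exprD; field.
by rewrite !expf_neq0.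
Qed.

Lemma separates_density B O (l : nat) : (0 < #|B|)%N -> B :&: O = finset.set0 ->
  Q.+1 = (2 ^ l.+1)%N -> (#|O| <= 2 ^ l.+1)%N ->
  #|B|%:R / (4 * (Q.+1%:R + #|B|%:R)) * #|{: {ffun T -> 'I_Q.+1}}|%:R
    <= #|[set f | separates (zeros f) (B, O)]|%:R :> R.
Proof.
move=> B0 BO EQ Ol; rewrite card_separates //; apply: ler_wpM2r => //.
set w : R := Q%:R / Q.+1%:R.
have q0 : 0 < Q.+1%:R :> R by rewrite ltr0n.
have w0 : 0 <= w by rewrite divr_ge0.
have w1 : w <= 1 by rewrite ler_pdivrMr // mul1r ler_nat.
have wO : 1 / 4 <= w ^+ #|O|.
  apply: le_trans (_ : w ^+ (2 ^ l.+1) <= _); last exact: ler_wiXn2l.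
  have -> : w = 1 - (2%:R ^+ l.+1)^-1.
    by rewrite /w -natrX -EQ -natr1; field; rewrite natr1 gt_eqF.
  (* Induction on the exponent shows that [(1 - 1/m)^m >= 1/4] for [m = 2^(l+1)]: doubling [m] only
     helps, since [(1 - 1/(2m))^2 >= 1 - 1/m]. *)
  elim: (l) => [|k IH]; first by rewrite expr1 expn1 expr2; lra.
  rewrite [(2 ^ k.+2)%N]expnS exprM; apply: le_trans IH _.
  have p0 : 0 < 2 ^+ k.+1 :> R by rewrite exprn_gt0.
  have p1 : (2 ^+ k.+1)^-1 <= 1 :> R by rewrite invf_le1 // exprn_ege1 // ler1n.
  apply: lerXn2r; rewrite ?nnegrE ?exprn_ge0 ?subr_ge0 //.
    by rewrite invf_le1 ?exprn_gt0 // exprn_ege1 // ler1n.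
  rewrite [2 ^+ k.+2]exprS invfM expr2.
  have := sqr_ge0 ((2 ^+ k.+1)^-1 : R); nra.
have wB : #|B|%:R / (Q.+1%:R + #|B|%:R) <= 1 - w ^+ #|B|.
  set b : R := #|B|%:R; have b0 : 0 < b by rewrite ltr0n.
  set a : R := Q.+1%:R in q0 *.
  have ab : a + b != 0 by rewrite gt_eqF // addr_gt0.
  have wa : w * (1 + a^-1) <= 1.
    have -> : w = 1 - a^-1 by rewrite /w /a -natr1; field; rewrite natr1 gt_eqF.
    by rewrite -subr_sqr expr1n lerBlDr lerDl sqr_ge0.
  have a0 : 0 <= a^-1 by rewrite invr_ge0 ltW.
  (* Bernoulli bounds [1 + b/a] by [(1 + 1/a)^b], and [w (1 + 1/a) = 1 - 1/a^2 <= 1]. *)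
  have h1 : w ^+ #|B| * (1 + b * a^-1) <= 1.
    apply: le_trans (_ : (w * (1 + a^-1)) ^+ #|B| <= _).
      by rewrite [leRHS]exprMn; apply: ler_wpM2l; rewrite ?exprn_ge0 // bernoulli_ineq.
    by rewrite exprn_ile1 // mulr_ge0 // addr_ge0.
  have -> : b / (a + b) = 1 - a / (a + b) by field.
  rewrite lerB // ler_pdivlMr ?addr_gt0 //.
  have -> : a + b = (1 + b * a^-1) * a by field; rewrite gt_eqF.
  by rewrite mulrA -[leRHS]mul1r ler_wpM2r // ltW.
have nB : 0 <= #|B|%:R / (Q.+1%:R + #|B|%:R) :> R by rewrite divr_ge0 // addr_ge0.
have n4 : 0 <= 1 / 4 :> R by lra.
apply: le_trans (ler_pM n4 nB wO wB); rewrite le_eqVlt; apply/orP; left; apply/eqP; field.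
by rewrite gt_eqF // addr_gt0 // ltr0n.
Qed.

End RandomZeroSet.

Section MatousekEmbedding.
Variables (R : realType) (T : finType) (G : {set {set T}}) (H q : nat) (Y : R).
Hypotheses (conn : graph_connected G) (HG : forall u v, (gdist G u v <= H)%N).
Hypotheses (q0 : (0 < q)%N) (Y1 : 1 <= Y) (Yq : #|T|%:R <= Y ^+ q).

Definition separated_at (A : {set T}) (p : T * T) : bool :=
  [exists i : 'I_q, separates A (matousek_ball G q p.1 p.2 i, matousek_open_ball G q p.1 p.2 i.+1)].

(** The scale depends on the pair. At a slow-growth index, [2^l <= 2 Y #|B|], so the density
    [#|B| / (4 (2^l + #|B|))] is at least [1/(12 Y)]. *)
Lemma separated_at_dense (p : T * T) : exists l : 'I_(maxn 1 (up_log 2 #|T|)),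
  (12 * Y)^-1 * #|{: {ffun T -> 'I_(2 ^ l.+1).-1.+1}}|%:R <=
  #|[set f : {ffun T -> 'I_(2 ^ l.+1).-1.+1} | separated_at (zeros f) p]|%:R.
Proof.
have [i iq hi] := @matousek_growth T G R Y q p.1 p.2 q0 (le_trans ler01 Y1) Yq.
set B := matousek_ball G q p.1 p.2 i in hi.
set O := matousek_open_ball G q p.1 p.2 i.+1.
have BO : B :&: O = finset.set0 by exact: matousek_disjoint.
have B0 : (0 < #|B|)%N.
  by rewrite card_gt0; apply/set0Pn; exists (matousek_center p.1 p.2 i); exact: matousek_ball_center.
have OY : #|O|%:R <= Y * #|B|%:R.
  by apply: le_trans hi; rewrite ler_nat subset_leq_card // matousek_open_ball_sub.
(* The least [l >= 1] with [#|O| <= 2^l]. Scales are indexed from 0, so the witness is [l.-1], whose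
   random sets have density [2^(-l)]. *)
set l := maxn 1 (up_log 2 #|O|).
have l0 : (0 < l)%N by rewrite leq_max.
have ll : (l.-1 < maxn 1 (up_log 2 #|T|))%N.
  by rewrite prednK // /l geq_max !leq_max /= leq_up_log ?orbT // max_card.
exists (Ordinal ll) => /=.
have l1 : l.-1.+1 = l by rewrite prednK.
have EQ : (2 ^ l.-1.+1).-1.+1 = (2 ^ l.-1.+1)%N by rewrite prednK // expn_gt0.
have Ol : (#|O| <= 2 ^ l.-1.+1)%N.
  by rewrite l1 (leq_trans (@up_logP 2 _ _)) // leq_exp2l // leq_maxr.
have h := @separates_density T _ R B O l.-1 B0 BO EQ Ol.
apply: le_trans (le_trans _ h) _; last first.
  rewrite ler_nat; apply/subset_leq_card/fintype.subsetP => f; rewrite !inE => hf.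
  by apply/existsP; exists (Ordinal iq).
apply: ler_wpM2r => //.
have bpos : 0 < #|B|%:R :> R by rewrite ltr0n.
have b1 : 1 <= #|B|%:R :> R by rewrite (ler_nat _ 1).
have Q2 : (2 ^ l.-1.+1).-1.+1%:R <= 2 * Y * #|B|%:R :> R.
  rewrite EQ l1; case: (leqP #|O| 1) => o1.
    have -> : l = 1%N by rewrite /l (eqP (_ : up_log 2 #|O| == 0)%N) // up_log_eq0.
    by rewrite expn1; have := Y1; have := b1; nra.
  have -> : l = up_log 2 #|O| by apply/maxn_idPr; rewrite up_log_gt0.
  rewrite -mulrA; apply: le_trans (ler_wpM2l _ OY) => //; rewrite -natrM ler_nat.
  rewrite -(prednK (_ : 0 < up_log 2 #|O|)%N) ?up_log_gt0 // expnS leq_mul2l /=.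
  exact/ltnW/up_log_gtn.
have Y0 : 0 < 12 * Y by have := Y1; lra.
have ab : 0 < 4 * ((2 ^ l.-1.+1).-1.+1%:R + #|B|%:R) :> R by rewrite mulr_gt0 // addr_gt0 // ltr0n.
rewrite ler_pdivlMr // mulrC ler_pdivrMr //.
have := Y1; move: Q2 b1; set a := _.+1%:R; set b := #|B|%:R; nra.
Qed.

Lemma covering_sets (l r : nat) : (1 - (12 * Y)^-1) ^+ r * #|T|%:R ^+ 2 < 1 ->
  exists A : 'I_r -> {set T}, forall p : T * T,
    (12 * Y)^-1 * #|{: {ffun T -> 'I_l.+1}}|%:R <=
      #|[set f : {ffun T -> 'I_l.+1} | separated_at (zeros f) p]|%:R ->
    exists j, separated_at (A j) p.
Proof.
move=> hr; pose good (p : T * T) (f : {ffun T -> 'I_l.+1}) := separated_at (zeros f) p.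
pose S := [set p | (12 * Y)^-1 * #|{: {ffun T -> 'I_l.+1}}|%:R <= #|[set f | good p f]|%:R].
have F0 : (0 < #|{: {ffun T -> 'I_l.+1}}|)%N by rewrite card_ffun card_ord expn_gt0.
have Y0 : 0 < 12 * Y by have := Y1; lra.
have th1 : (12 * Y)^-1 <= 1 by rewrite invf_le1 //; have := Y1; lra.
have dense p : p \in S -> (12 * Y)^-1 * #|{: {ffun T -> 'I_l.+1}}|%:R <= #|[set f | good p f]|%:R.
  by rewrite inE.
have hS : (1 - (12 * Y)^-1) ^+ r * #|S|%:R < 1.
  apply: le_lt_trans hr; apply: ler_wpM2l; first by rewrite exprn_ge0 // subr_ge0.
  by rewrite -natrX ler_nat -mulnn -card_prod max_card.
have [s sr hs] := full_covering F0 th1 dense hS.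
exists (fun j => zeros (nth [ffun=> ord0] s j)) => p hp.
have /hasP[f fs gf] : has (good p) s by apply: hs; rewrite inE.
have lt : (index f s < r)%N by rewrite -sr index_mem.
by exists (Ordinal lt); rewrite /= nth_index.
Qed.

(** At each scale, [r] greedily chosen sets serve all pairs dense at that scale; every pair is dense
    at some scale, so some coordinate separates it. *)
Lemma matousek_embedding (r : nat) : (1 - (12 * Y)^-1) ^+ r * #|T|%:R ^+ 2 < 1 ->
  exists phi : T -> {ffun 'I_(maxn 1 (up_log 2 #|T|)) * 'I_r -> 'I_H.+1}, forall u v,
    (gdist G u v <= q.*2.-1 * box_dist (phi u) (phi v))%N /\
    (box_dist (phi u) (phi v) <= gdist G u v)%N.
Proof.
move=> hr; have [A hA] := fin_all_exists (fun l : 'I_(maxn 1 (up_log 2 #|T|)) =>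
  @covering_sets (2 ^ l.+1).-1 r hr).
exists (fun u => [ffun i => inord (set_dist G H (A i.1 i.2) u)]) => u v.
have val_phi i w : val (inord (set_dist G H (A i.1 i.2) w) : 'I_H.+1) = set_dist G H (A i.1 i.2) w.
  by rewrite /= inordK // ltnS set_dist_default.
split; last first.
  apply/box_dist_leqP => i; rewrite !ffunE !val_phi set_dist_lipschitz //.
  by rewrite (gdist_sym conn) set_dist_lipschitz.
have [l hl] := separated_at_dense (u, v).
have [j /existsP[i sep]] := hA l (u, v) hl.
have := matousek_separated conn (ltn_ord i) (HG u v) sep.
move=> /leq_trans; apply; rewrite leq_mul2l; apply/orP; right.
apply: leq_trans (leq_bigmax (l, j)).
by rewrite !ffunE !val_phi.
Qed.

End MatousekEmbedding.

Local Open Scope nat_scope.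

(** * The lower bound on the distortion *)

(** The least [m] with half of the values at most [m]: by minimality fewer than half lie below
    it. *)
Lemma median_exists (T : finType) (f : T -> nat) : exists m,
  #|T| <= #|[set u | f u <= m]|.*2 /\ #|T| <= #|[set u | m <= f u]|.*2.
Proof.
have ex : exists m, #|T| <= #|[set u | f u <= m]|.*2.
  exists (\max_u f u); rewrite (_ : [set u | _] = [set: T]) ?cardsT; first by lia.
  by apply/setP => u; rewrite !inE leq_bigmax.
exists (ex_minn ex); case: ex_minnP => m hm min; split=> //.
case: m hm min => [|m] hm min.
  by rewrite (_ : [set u | _] = [set: T]) ?cardsT; [lia | apply/setP => u; rewrite !inE].
have : #|[set u | f u <= m]|.*2 < #|T| by rewrite ltnNge; apply/negP => /min; rewrite ltnn.
have -> : [set u | m < f u] = ~: [set u | f u <= m] by apply/setP => u; rewrite !inE ltnNge.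
have := cardsC [set u | f u <= m]; lia.
Qed.

Lemma leq_sub_triangle (a b c : nat) : a - c <= (a - b) + (b - c).
Proof. lia. Qed.

Section Balls.
Variables (T : finType) (G : {set {set T}}).

Lemma iter_nbhd_mono (A : {set T}) i j : i <= j -> iter i (nbhd G) A \subset iter j (nbhd G) A.
Proof.
move=> /subnK <-; elim: (j - i) => // k IH.
by rewrite addSn iterS; apply: fintype.subset_trans IH (sub_nbhd _ _).
Qed.

Lemma path_iter_nbhd a (p : seq T) : path (adj G) a p -> last a p \in iter (size p) (nbhd G) [set a].
Proof.
elim/last_ind: p => [|p x IH]; first by rewrite inE.
rewrite rcons_path last_rcons size_rcons => /andP[pp px] /=.
rewrite inE; apply/orP; right; rewrite inE; apply/existsP; exists (last a p).
by rewrite px IH.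
Qed.

Lemma gdist_iter_nbhd u v j : graph_connected G -> gdist G u v <= j -> v \in iter j (nbhd G) [set u].
Proof.
move=> conn uv; have [p [pp lp sp]] := gdist_walk (graph_connectedP conn u v).
rewrite -{1}lp; apply: (fintype.subsetP (iter_nbhd_mono _ _)) (path_iter_nbhd pp).
by rewrite sp.
Qed.

End Balls.

Section LowerBound.
Variables (R : realType) (T I : finType) (G : {set {set T}}) (H d K R0 j : nat).
Variables (phi : T -> {ffun I -> 'I_H.+1}) (s D : R).
Hypotheses (T0 : 0 < #|T|) (conn : graph_connected G) (regG : regular G d) (expG : edge_expander G K).
Hypotheses (s0 : (0 < s)%R) (D0 : (0 < D)%R) (R00 : 0 < R0).
Hypothesis ballR0 : 2 * d.+1 ^ R0 <= #|T|.
Hypothesis hj : 4 * #|I| * (K * d) ^ j < (K * d).+1 ^ j.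
Hypothesis lowphi : forall u v, (s * (gdist G u v)%:R <= (box_dist (phi u) (phi v))%:R)%R.
Hypothesis uphi : forall u v, ((box_dist (phi u) (phi v))%:R <= s * D * (gdist G u v)%:R)%R.

Let far (mu : I -> nat) i : {set T} :=
  [set u | (s * R0%:R <= 2 * (phi u i - mu i)%:R)%R] :|: [set u | (s * R0%:R <= 2 * (mu i - phi u i)%:R)%R].

(** Otherwise at least three quarters of the vertices are far in no coordinate. Any two of these
    have images less than [s * R0] apart, hence distance less than [R0], so they all fit in a ball
    of at most [#|T|/2] vertices. *)
Lemma far_coordinate (mu : I -> nat) : exists i, #|T| <= 4 * #|I| * #|far mu i|.
Proof.
apply: contrapT => /forallNP h.
pose W := ~: \bigcup_i far mu i.
have hU : 4 * #|\bigcup_i far mu i| <= #|T|.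
  have [I0|I0] := posnP #|I|.
    rewrite big_pred0 ?cards0 // => i; by have := card0_eq I0 i.
  rewrite -(leq_pmul2l I0); apply: leq_trans (_ : \sum_(i : I) #|T| <= _); last by rewrite sum_nat_const.
  apply: leq_trans (_ : #|I| * (4 * \sum_i #|far mu i|) <= _).
    by rewrite !leq_mul // leq_card_bigcup.
  rewrite mulnA [#|I| * 4]mulnC big_distrr; apply: leq_sum => i _.
  by rewrite ltnW // ltnNge; apply/negP/h.
have cW : #|W| + #|\bigcup_i far mu i| = #|T| by rewrite addnC cardsC.
have /card_gt0P[w wW] : 0 < #|W| by lia.
suff sub : W \subset iter R0 (nbhd G) [set w].
  have := subset_leq_card sub; have := iter_nbhd_card regG R0 [set w]; rewrite cards1 muln1; lia.
have near x i : x \in W -> (2 * (phi x i - mu i)%:R < s * R0%:R)%R /\ (2 * (mu i - phi x i)%:R < s * R0%:R)%R.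
  rewrite inE => /bigcupP hx; split; rewrite ltNge; apply/negP => hh; apply: hx; exists i => //.
    by rewrite !inE hh.
  by rewrite !inE hh orbT.
apply/fintype.subsetP => u uW; apply: gdist_iter_nbhd => //.
(* Equal images force [gdist G w u = 0]; otherwise some coordinate realizes the box distance, and
   the triangle inequality through [mu i] bounds it. *)
have [b0|b0] := posnP (box_dist (phi w) (phi u)).
  by have := lowphi w u; rewrite b0 pmulr_rle0 // (ler_nat _ _ 0); lia.
have [i hi] := box_dist_attained b0.
have [n1 n2] := near w i wW; have [n3 n4] := near u i uW.
rewrite ltnW // -(ltr_nat R) -(ltr_pM2l s0); apply: le_lt_trans (lowphi w u) _.
have : ((box_dist (phi w) (phi u))%:R <= (phi w i - mu i)%:R + (mu i - phi u i)%:R :> R \/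
  (box_dist (phi w) (phi u))%:R <= (phi u i - mu i)%:R + (mu i - phi w i)%:R :> R)%R.
  by case: hi => hi; [left | right]; rewrite -natrD ler_nat (leq_trans hi) // leq_sub_triangle.
by case; lra.
Qed.

(** Take [mu] to be the coordinatewise medians. One side of the far set has at least
    [#|T| / (8 #|I|)] vertices, and the half beyond the median comes within distance [j] of it; then
    [s R0 / 2 <= s D j]. *)
Lemma distortion_lower_bound : (R0%:R <= 2 * D * j%:R :> R)%R.
Proof.
have [mu hmu] := choice (fun i => median_exists (fun u => phi u i : nat)).
have [i hi] := far_coordinate mu.
have [le_med ge_med] := hmu i.
have big (A : {set T}) : #|T| <= 8 * #|I| * #|A| -> (K * d) ^ j * #|T| < (K * d).+1 ^ j * #|A|.*2.
  move=> hA; have A0 : 0 < #|A| by nia.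
  apply: leq_ltn_trans (_ : (4 * #|I| * (K * d) ^ j) * #|A|.*2 < _); last by rewrite ltn_pmul2r // double_gt0.
  apply: leq_trans (leq_mul (leqnn _) hA) _; rewrite -mul2n; apply: eq_leq; ring.
have close a b : gdist G a b <= j -> (s * R0%:R <= 2 * (box_dist (phi a) (phi b))%:R)%R -> (R0%:R <= 2 * D * j%:R :> R)%R.
  move=> ab h; rewrite -(ler_pM2l s0); apply: le_trans h _.
  have -> : (s * (2 * D * j%:R) = 2 * (s * D * j%:R))%R by ring.
  rewrite ler_pM2l //; apply: le_trans (uphi a b) _.
  by rewrite ler_pM2l ?mulr_gt0 // ler_nat.
case: (leqP #|T| (8 * #|I| * #|[set u | (s * R0%:R <= 2 * (phi u i - mu i)%:R)%R]|)) => [up|up].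
  have [a [b [aA bB ab]]] := expander_close_sets regG expG (big _ up) le_med.
  apply: close ab _; move: aA bB; rewrite !inE => /le_trans h bm; apply: h.
  rewrite ler_pM2l // ler_nat; apply: leq_trans (box_dist_geq _ _ i); lia.
have dn : #|T| <= 8 * #|I| * #|[set u | (s * R0%:R <= 2 * (mu i - phi u i)%:R)%R]|.
  move: hi; rewrite /far; set X := [set u | _] in up *; set X' := [set u | _] in up *.
  have := cardsU X X'; nia.
have [a [b [aA bB ab]]] := expander_close_sets regG expG (big _ dn) ge_med.
apply: close ab _; move: aA bB; rewrite !inE => /le_trans h bm; apply: h.
rewrite ler_pM2l // ler_nat box_dist_sym; apply: leq_trans (box_dist_geq _ _ i); lia.
Qed.

End LowerBound.

Local Open Scope ring_scope.

(** * Choice of the parameters *)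

Section Logarithms.
Variable R : realType.
Implicit Types t : R.

Lemma nat_above t : 0 <= t -> exists m : nat, t < m%:R <= t + 1.
Proof.
move=> t0; exists (Num.truncn t).+1; have /andP[h1 h2] := truncn_itv t0.
by rewrite h2 -natr1 lerD2r.
Qed.

Lemma ler_ln_pos (a b : R) : 0 < a -> a <= b -> ln a <= ln b.
Proof. by move=> a0 ab; rewrite ler_ln ?posrE // (lt_le_trans a0). Qed.

Lemma expR1_lt4 : expR 1 < 4 :> R.
Proof.
(* From [exp(-1/4) >= 3/4]; then [exp 1 <= (4/3)^4 = 256/81 < 4]. *)
have h : expR (1 / 4) <= 4 / 3 :> R.
  have h := expR_ge1Dx (- (1 / 4) : R).
  by rewrite -[1 / 4]opprK expRN -div1r ler_pdivrMr ?expR_gt0 //; lra.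
have -> : 1 = 4%:R * (1 / 4) :> R by field.
rewrite expRM_natl; apply: le_lt_trans (_ : (4 / 3) ^+ 4 < _); last by lra.
by apply: lerXn2r => //; rewrite nnegrE ?expR_ge0.
Qed.

Lemma ln4_gt1 : 1 < ln 4 :> R.
Proof. by rewrite -[ltLHS]expRK ltr_ln ?posrE ?expR_gt0 ?expR1_lt4. Qed.

Lemma ln2_gt : 1 / 2 < ln 2 :> R.
Proof.
have := ln4_gt1; have -> : 4 = 2 ^+ 2 :> R by rewrite -natrX.
by rewrite lnXn // mulr2n; lra.
Qed.

Lemma ln2_le1 : ln 2 <= 1 :> R.
Proof. by have -> : 2 = 1 + 1 :> R by []; apply: le_ln1Dx; lra. Qed.

Lemma expR_ln_bound (t : R) : exists N, forall n, (N <= n)%N -> t <= ln n%:R.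
Proof.
exists (Num.bound (expR t)) => m hm.
rewrite -[leLHS]expRK; apply: ler_ln_pos; first exact: expR_gt0.
apply: le_trans (ltW (archi_boundP (expR_ge0 t))) _.
by rewrite ler_nat.
Qed.

Lemma up_log_ln (n : nat) : (4 <= n)%N ->
  ln (n%:R : R) <= (maxn 1 (up_log 2 n))%:R <= 3 * ln (n%:R : R).
Proof.
move=> n4; have L0 : (0 < up_log 2 n)%N by rewrite up_log_gt0 (leq_trans _ n4).
rewrite (maxn_idPr L0); set L := up_log 2 n in L0 *.
have n0 : 0 < n%:R :> R by rewrite ltr0n (leq_trans _ n4).
have l1 : 1 < ln n%:R :> R.
  by apply: lt_le_trans ln4_gt1 _; apply: ler_ln_pos; rewrite // ler_nat.
apply/andP; split.
  have : ln n%:R <= ln (2 ^+ L) :> R by rewrite ler_ln_pos // -natrX ler_nat up_logP.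
  rewrite lnXn // -[ln 2 *+ _]mulr_natr => h; apply: le_trans h _.
  by rewrite ler_piMl // ln2_le1.
have : ln (2 ^+ L.-1) <= ln n%:R :> R.
  rewrite ler_ln_pos ?exprn_gt0 // -natrX ler_nat ltnW // up_log_gtn //.
  exact: leq_trans n4.
rewrite lnXn // -[ln 2 *+ _]mulr_natr; have := ln2_gt.
have -> : L%:R = L.-1%:R + 1 :> R by rewrite natr1 prednK.
have : 0 <= L.-1%:R :> R by [].
nra.
Qed.

End Logarithms.

Section EmbeddingScales.
Variables (R : realType) (n k : nat).
Hypotheses (n4 : (4 <= n)%N) (nk : (n <= k)%N).

Let x : R := ln n%:R.
Let y : R := ln k%:R.
Let Y : R := Num.min n%:R y.
Let mu : R := Num.min x (ln y).

(** A positive lower bound for [ln (ln n)], and so for [mu], valid for all [n >= 4]; dividing by it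
    absorbs additive constants into multiples of [mu]. *)
Definition kappa : R := ln (ln (4 : R)).

Lemma kappa_gt0 : 0 < kappa.
Proof. by rewrite ln_gt0 // ln4_gt1. Qed.

Lemma n_gt0 : 0 < n%:R :> R.
Proof. by rewrite ltr0n (leq_trans _ n4). Qed.

Lemma ln4_le_x : ln 4 <= x.
Proof. by apply: ler_ln_pos; rewrite // ler_nat. Qed.

Lemma x_gt1 : 1 < x.
Proof. exact: lt_le_trans (ln4_gt1 R) ln4_le_x. Qed.

Lemma x_le_y : x <= y.
Proof. by apply: ler_ln_pos; rewrite ?n_gt0 // ler_nat. Qed.

Lemma kappa_le : kappa <= ln x.
Proof. by apply: ler_ln_pos ln4_le_x; apply: lt_trans (ln4_gt1 R). Qed.

Lemma Y_gt1 : 1 < Y.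
Proof.
rewrite /Y lt_min (lt_le_trans x_gt1 x_le_y) andbT.
by rewrite (ltr_nat R 1) (leq_trans _ n4).
Qed.

Lemma lnY : ln Y = mu.
Proof.
have y0 : 0 < y by apply: lt_trans (lt_le_trans x_gt1 x_le_y).
rewrite /Y /mu; case: (leP n%:R y) => h.
  by rewrite (min_idPl _) // ler_ln_pos ?n_gt0.
by rewrite (min_idPr _) // ler_ln_pos // ltW.
Qed.

Lemma lnx_le_mu : ln x <= mu.
Proof.
have x0 : 0 < x by apply: lt_trans x_gt1.
rewrite /mu le_min ltW ?ln_sublinear //= ler_ln_pos //; exact: x_le_y.
Qed.

Lemma mu_gt0 : 0 < mu.
Proof. exact: lt_le_trans kappa_gt0 (le_trans kappa_le lnx_le_mu). Qed.

Lemma mu_le_x : mu <= x.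
Proof. by rewrite /mu ge_min lexx. Qed.

(** Since [ln Y = mu], any [q >= x / mu] gives [n <= Y^q]. Taking [q <= x / mu + 1] yields
    [2q - 1 <= 2 x / mu + 1 <= 3 x / mu], as [mu <= x]. *)
Lemma embedding_exponent : exists q : nat,
  [/\ (0 < q)%N, n%:R <= Y ^+ q & q.*2.-1%:R <= 3 * x / mu].
Proof.
have m0 := mu_gt0; have xm : 1 <= x / mu by rewrite ler_pdivlMr // mul1r mu_le_x.
have [q /andP[q1 q2]] := nat_above (le_trans ler01 xm).
have q0 : (0 < q)%N by rewrite -(ltr_nat R); lra.
exists q; split=> //.
  have Y0 : 0 < Y by apply: lt_trans Y_gt1.
  rewrite -ler_ln ?posrE ?exprn_gt0 ?n_gt0 // lnXn // lnY -[mu *+ _]mulr_natl -/x.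
  by rewrite -ler_pdivrMr // ltW.
have -> : q.*2.-1%:R = 2 * q%:R - 1 :> R.
  by rewrite -subn1 natrB ?double_gt0 // -mul2n natrM.
by rewrite -mulrA; lra.
Qed.

(** The covering condition follows from [exp(2x - r/(12 Y)) < 1], that is [r > 24 Y x]. Rounding up
    costs at most [Y x], and the number of scales lies between [x] and [3x]; hence 24 and 75. *)
Lemma embedding_dimension : exists r : nat,
  (1 - (12 * Y)^-1) ^+ r * n%:R ^+ 2 < 1 /\
  24 * Y * x ^+ 2 <= (maxn 1 (up_log 2 n) * r)%:R <= 75 * Y * x ^+ 2.
Proof.
have Y1 := Y_gt1; have x1 := x_gt1.
have Yx : 1 <= Y * x by rewrite -[1]mulr1 ler_pM // ltW.
have t0 : 0 <= 24 * (Y * x) by lra.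
have [r /andP[r1 r2]] := nat_above t0.
exists r; split.
  have th : 1 - (12 * Y)^-1 <= expR (- (12 * Y)^-1) by exact: expR_ge1Dx.
  have th0 : 0 <= 1 - (12 * Y)^-1 by rewrite subr_ge0 invf_le1; lra.
  have E : n%:R ^+ 2 = expR (2%:R * x) by rewrite expRM_natl /x lnK // posrE n_gt0.
  rewrite E; apply: le_lt_trans (_ : expR (- (12 * Y)^-1) ^+ r * expR (2%:R * x) < _).
    apply: ler_wpM2r; first exact: expR_ge0.
    by apply: lerXn2r => //; rewrite nnegrE ?expR_ge0.
  rewrite -expRM_natl -expRD -[ltRHS]expR0 ltr_expR mulrN addrC subr_lt0.
  by rewrite ltr_pdivlMr; lra.
have /andP[L1 L2] := up_log_ln R n4; rewrite -/x in L1 L2.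
rewrite natrM; set L := (maxn _ _)%:R in L1 L2 *.
apply/andP; split.
  have -> : 24 * Y * x ^+ 2 = x * (24 * (Y * x)) by ring.
  by apply: ler_pM => //; lra.
have -> : 75 * Y * x ^+ 2 = (3 * x) * (25 * (Y * x)) by ring.
by apply: ler_pM => //; lra.
Qed.

(** The square makes [H] exceed both [500 x] and, for large [n], the diameter of any expander with
    fixed constants, while [ln H] remains of order [ln x]. *)
Lemma coordinate_range : exists H : nat, 500 * x ^+ 2 <= H%:R <= 500 * x ^+ 2 + 1.
Proof.
have t0 : 0 <= 500 * x ^+ 2 by have := sqr_ge0 x; lra.
have [H /andP[h1 h2]] := nat_above t0.
by exists H; rewrite (ltW h1).
Qed.

Definition log_const : R := ln 502 / kappa + 2.

Lemma ln_range (H : nat) : 500 * x ^+ 2 <= H%:R <= 500 * x ^+ 2 + 1 ->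
  1 <= ln (H.+1%:R : R) /\ ln x <= ln (H.+1%:R : R) <= log_const * ln x.
Proof.
have x1 := x_gt1; have x2 : x <= x ^+ 2 by rewrite expr2 ler_peMl // ltW //; lra.
rewrite -natr1 => /andP[h1 h2]; split.
  apply: le_trans (ltW (ln4_gt1 R)) _; apply: ler_ln_pos; lra.
apply/andP; split; first by apply: ler_ln_pos; lra.
apply: le_trans (_ : ln (502 * x ^+ 2) <= _); first by apply: ler_ln_pos; lra.
have p502 : 0 < 502 :> R by lra.
have x0 : 0 < x by lra.
rewrite lnM ?posrE ?exprn_gt0 ?p502 // lnXn ?mulr2n //.
rewrite /log_const mulrDl -lerBlDr.
have -> : ln 502 + (ln x + ln x) - 2 * ln x = ln 502 by ring.
have k0 := kappa_gt0; have kl := kappa_le.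
have l502 : 0 <= ln 502 :> R by apply: ln_ge0; lra.
by rewrite -mulrA ler_peMr // mulrC ler_pdivlMr // mul1r.
Qed.

Definition size_const : R := 75 * log_const.

(** Expanding [ln (size_const * Lg)] leaves [ln size_const] and [2 ln x + ln (ln x) + mu], the
    latter at most [4 mu]. *)
Definition doubly_log_const : R := ln size_const / kappa + 4.

Lemma log_const_ge2 : 2 <= log_const.
Proof. have l502 : 0 <= ln 502 :> R by apply: ln_ge0; lra.
by rewrite lerDr; apply: divr_ge0 l502 (ltW kappa_gt0). Qed.

Let Lg : R := x ^+ 2 * ln x * Y.

Lemma size_bounds (H m : nat) : 500 * x ^+ 2 <= H%:R <= 500 * x ^+ 2 + 1 ->
  24 * Y * x ^+ 2 <= m%:R <= 75 * Y * x ^+ 2 ->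
  let N := (H.+1 ^ m)%N in
  (expR (24 * Lg) <= N%:R /\ N%:R <= expR (size_const * Lg)) /\
  mu <= Num.min x (ln (ln N%:R)) <= doubly_log_const * mu.
Proof.
move=> hH /andP[m1 m2] N; have [H1 /andP[H2 H3]] := ln_range hH.
have x1 := x_gt1; have Y1 := Y_gt1; have k0 := kappa_gt0; have kl := kappa_le.
have x2 : x <= x ^+ 2 by rewrite expr2 ler_peMl // ltW //; lra.
have z0 : 0 < ln x by lra.
have lc := log_const_ge2.
have p0 : 0 < Y * x ^+ 2 by rewrite mulr_gt0 //; lra.
have N0 : 0 < N%:R :> R by rewrite ltr0n expn_gt0.
have lnN : ln N%:R = m%:R * ln H.+1%:R :> R by rewrite natrX lnXn ?ltr0n // -[_ *+ m]mulr_natl.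
have low : 24 * Lg <= ln N%:R.
  rewrite lnN; have -> : 24 * Lg = 24 * Y * x ^+ 2 * ln x by rewrite /Lg; ring.
  by apply: ler_pM; lra.
have up : ln N%:R <= size_const * Lg.
  rewrite lnN; have -> : size_const * Lg = 75 * Y * x ^+ 2 * (log_const * ln x) by rewrite /size_const /Lg; ring.
  by apply: ler_pM; lra.
have YN : Y <= ln N%:R.
  rewrite lnN; apply: le_trans (_ : m%:R * 1 <= _); last by apply: ler_wpM2l.
  by rewrite mulr1; apply: le_trans m1; nra.
split.
  by rewrite -{1}[N%:R]lnK ?posrE // -{2}[N%:R]lnK ?posrE // !ler_expR.
have sc : 1 <= size_const by rewrite /size_const; lra.
apply/andP; split.
  by rewrite le_min mu_le_x /= -lnY ler_ln_pos //; lra.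
rewrite ge_min; apply/orP; right.
apply: le_trans (ler_ln_pos _ up) _; first by apply: lt_le_trans YN; lra.
have -> : ln (size_const * Lg) = ln size_const + (ln x *+ 2 + ln (ln x) + mu).
  rewrite lnM ?posrE /Lg ?mulr_gt0 //; try lra.
  rewrite lnM ?posrE ?mulr_gt0 //; try lra.
  by rewrite lnM ?posrE ?lnXn ?lnY //; lra.
have h1 := lnx_le_mu; have h2 : ln (ln x) <= ln x by rewrite ltW // ln_sublinear.
have h3 : ln size_const <= ln size_const / kappa * mu.
  rewrite -mulrA ler_peMr ?ln_ge0 // mulrC ler_pdivlMr // mul1r; lra.
by rewrite /doubly_log_const mulrDl mulr2n; lra.
Qed.

Lemma doubly_log_const_ge4 : 4 <= doubly_log_const.
Proof.
have sc : 1 <= size_const by rewrite /size_const; have := log_const_ge2; lra.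
by rewrite lerDr; apply: divr_ge0 (ln_ge0 sc) (ltW kappa_gt0).
Qed.

End EmbeddingScales.

Section Distortion.
Variables (R : realType) (T I : finType) (H : nat) (G : {set {set T}}).

Lemma distortion_box_le (phi : T -> {ffun I -> 'I_H.+1}) (D : nat) : (0 < D)%N ->
  (forall u v, (gdist G u v <= D * box_dist (phi u) (phi v))%N /\
    (box_dist (phi u) (phi v) <= gdist G u v)%N) ->
  (distortion (box R I H) G <= D%:R%:E)%E.
Proof.
move=> D0 h; apply: ereal_inf_lbound; exists D%:R => //=; split; first by rewrite ltr0n.
have DR : 0 < D%:R :> R by rewrite ltr0n.
exists phi, D%:R^-1; split; first by rewrite invr_gt0.
move=> v u; rewrite box_mdistE; have [h1 h2] := h v u.
rewrite mulVf ?gt_eqF // mul1r ler_nat; split=> //.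
by rewrite mulrC ler_pdivrMr // -natrM ler_nat mulnC.
Qed.

Lemma le_distortion_box (c : R) :
  (forall (phi : T -> {ffun I -> 'I_H.+1}) (s D : R), 0 < s -> 0 < D ->
    (forall u v, s * (gdist G u v)%:R <= (box_dist (phi u) (phi v))%:R) ->
    (forall u v, (box_dist (phi u) (phi v))%:R <= s * D * (gdist G u v)%:R) -> c <= D) ->
  (c%:E <= distortion (box R I H) G)%E.
Proof.
move=> h; apply/ereal_infP => _ [D [D0 [phi [s [s0 hphi]]]] <-]; rewrite lee_fin.
by apply: (h phi s D) => // u v; have [] := hphi u v.
Qed.

End Distortion.

(** * Logarithmic diameter and the distortion lower bound for expanders, with explicit parameters *)

Section LargeGraphs.
Variable R : realType.

Lemma ltn_exp_growth (a e j : nat) : (0 < a)%N -> (0 < e)%N ->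
  ln a%:R < j%:R * (ln e.+1%:R - ln e%:R) :> R -> (a * e ^ j < e.+1 ^ j)%N.
Proof.
move=> a0 e0; have aR : 0 < a%:R :> R by rewrite ltr0n.
have eR : 0 < e%:R :> R by rewrite ltr0n.
have eR' : 0 < e.+1%:R :> R by rewrite ltr0n.
move=> h; rewrite -(ltr_nat R) natrM !natrX -ltr_ln ?posrE ?mulr_gt0 ?exprn_gt0 //.
rewrite lnM ?posrE ?exprn_gt0 // !lnXn // -[ln e%:R *+ j]mulr_natl -[ln e.+1%:R *+ j]mulr_natl.
by rewrite -ltrBrDr -mulrBr.
Qed.

Lemma expander_distortion (d K : nat) : (0 < d)%N -> (0 < K)%N ->
  exists (b : R) (n1 : nat), 0 < b /\
  forall (n k H : nat) (I : finType) (G : {set {set 'I_n}}),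
    (4 <= n)%N -> (n1 <= n)%N -> (n <= k)%N ->
    let x : R := ln n%:R in let mu := Num.min x (ln (ln k%:R)) in
    #|I|%:R <= 75 * Num.min n%:R (ln k%:R) * x ^+ 2 -> (0 < #|I|)%N -> 500 * x ^+ 2 <= H%:R ->
    regular G d -> edge_expander G K ->
    [/\ graph_connected G, (diam G <= H)%N & ((b * (x / mu))%:E <= distortion (box R I H) G)%E].
Proof.
move=> d0 K0; pose e := (K * d)%N; have e0 : (0 < e)%N by rewrite muln_gt0 K0.
have eR : 0 < e%:R :> R by rewrite ltr0n.
pose eta : R := ln e.+1%:R - ln e%:R.
have eta0 : 0 < eta by rewrite subr_gt0 ltr_ln ?posrE ?ltr0n // ltr_nat.
pose delta : R := ln d.+1%:R.
have delta0 : 0 < delta by rewrite ln_gt0 // ltr1n.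
have k0 := kappa_gt0 R; set kap := kappa R in k0.
(* Chosen so that [j <= C * mu]: [ln (4 #|I|) <= ln 300 + mu + 2 ln x], and the term [kap^-1] pays
   for rounding [j] up. *)
pose C : R := (ln 300 / kap + 3) / eta + kap^-1.
have l300 : 0 <= ln 300 :> R by apply: ln_ge0; lra.
have C0 : 0 < C.
  by rewrite addr_gt0 ?invr_gt0 // divr_gt0 // ltr_wpDl // divr_ge0 // ltW.
(* The summand [eta^-1 + 1] keeps the diameter below [H]; [2 * (1 + delta)] makes [R0] at least
   [x / (2 delta)] after rounding. *)
have [n1 hn1] := expR_ln_bound (eta^-1 + 1 + 2 * (1 + delta)).
exists (4 * delta * C)^-1, n1; split; first by rewrite invr_gt0 !mulr_gt0.
move=> n k H I G n4 nn1 nk x mu m2 m0 hH rG xG.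
have eta1 : 0 < eta^-1 by rewrite invr_gt0.
have xbig : eta^-1 + 1 + 2 * (1 + delta) <= x by exact: hn1.
have x1 : 1 < x := x_gt1 R n4.
have mu0 : 0 < mu := mu_gt0 R n4 nk.
have kx : kap <= ln x := kappa_le R n4.
have xmu : ln x <= mu := lnx_le_mu R n4 nk.
have n0 : 0 < n%:R :> R := n_gt0 R n4.
have n0' : (0 < n)%N by rewrite -(ltr0n R).
set Y := Num.min n%:R _ in m2.
have Y1 : 1 < Y := Y_gt1 R n4 nk.
have lY : ln Y = mu := lnY R n4 nk.
have xe0 : 0 <= x / eta by rewrite divr_ge0 ?ltW //; lra.
have [j' /andP[j1 j2]] := nat_above xe0.
have hj' : ((K * d) ^ j' * #|'I_n| < (K * d).+1 ^ j' * 2)%N.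
  rewrite card_ord mulnC; apply: leq_trans (ltn_exp_growth n0' e0 _) _; last by rewrite leq_pmulr.
  by rewrite -/x -/eta -ltr_pdivrMr.
have conn := expander_connected rG xG hj'.
have dG := expander_diam rG xG hj'.
split=> //.
  apply: leq_trans dG _; rewrite -(ler_nat R); apply: le_trans hH.
  rewrite -mul2n natrM.
  have : x / eta + 1 <= x * x.
    apply: le_trans (_ : x * (eta^-1 + 1) <= _); first by rewrite mulrDr; lra.
    by rewrite ler_pM2l; lra.
  have := sqr_ge0 x; rewrite expr2; lra.
apply: le_distortion_box => phi s D s0 D0 lowphi uphi.
(* [R0 <= t] is exactly the condition [2 (d+1)^R0 <= n] in logarithms. *)
pose t : R := (x - ln 2) / delta.
have ln2 := ln2_le1 R; have ln2' := ln2_gt R.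
have t0 : 0 <= t by rewrite divr_ge0 ?(ltW delta0) //; lra.
have /andP[r1 r2] := truncn_itv t0; set R0 := Num.truncn t in r1 r2.
have R0big : x / (2 * delta) <= R0%:R.
  have -> : x / (2 * delta) = x / 2 / delta by rewrite invfM mulrA.
  rewrite -natr1 in r2.
  have : x / 2 / delta + 1 <= t.
    rewrite /t ler_pdivlMr // mulrDl mul1r divfK ?gt_eqF //; lra.
  lra.
have R0pos : (0 < R0)%N.
  rewrite -(ltr_nat R); apply: lt_le_trans R0big; rewrite divr_gt0 ?mulr_gt0 //; lra.
have ballR0 : (2 * d.+1 ^ R0 <= #|'I_n|)%N.
  rewrite card_ord -(ler_nat R) natrM natrX -ler_ln ?posrE ?mulr_gt0 ?exprn_gt0 ?ltr0n //.
  rewrite lnM ?posrE ?exprn_gt0 ?ltr0n // lnXn ?ltr0n // -[_ *+ R0]mulr_natl -/x -/delta.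
  by move: r1; rewrite /t ler_pdivlMr //; lra.
pose m := #|I|; have mR : 0 < m%:R :> R by rewrite ltr0n.
have l4m : 0 <= ln (4 * m)%:R :> R by apply: ln_ge0; rewrite (ler_nat _ 1) muln_gt0.
have le0 : 0 <= ln (4 * m)%:R / eta by rewrite divr_ge0 // ltW.
have [j /andP[jl ju]] := nat_above le0.
have hj : (4 * #|I| * (K * d) ^ j < (K * d).+1 ^ j)%N.
  have jl' : ln (4 * m)%:R < j%:R * eta by rewrite -ltr_pdivrMr.
  by apply: ltn_exp_growth e0 jl'; rewrite muln_gt0.
have n0T : (0 < #|'I_n|)%N by rewrite card_ord.
have main := distortion_lower_bound n0T conn rG xG s0 D0 R0pos ballR0 hj lowphi uphi.
have jC : j%:R <= C * mu.
  have u1 : ln (4 * m)%:R <= (ln 300 / kap + 3) * mu.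
    apply: le_trans (_ : ln (300 * (Y * x ^+ 2)) <= _).
      by rewrite ler_ln_pos ?ltr0n ?muln_gt0 // natrM; lra.
    have x0 : 0 < x by lra.
    have p300 : 0 < 300 :> R by lra.
    have Y0 : 0 < Y by lra.
    rewrite lnM ?posrE ?mulr_gt0 ?exprn_gt0 ?p300 // lnM ?posrE ?exprn_gt0 // lY lnXn //.
    rewrite mulrDl mulr2n.
    have : ln 300 <= ln 300 / kap * mu.
      by rewrite -mulrA ler_peMr // mulrC ler_pdivlMr // mul1r; lra.
    lra.
  apply: le_trans ju _; rewrite /C mulrDl; apply: lerD.
    by rewrite ler_pdivrMr // [leRHS]mulrAC divfK ?gt_eqF.
  by rewrite mulrC ler_pdivlMr // mul1r; lra.
rewrite mulrC ler_pdivrMr ?mulr_gt0 // ler_pdivrMr //.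
have : x / (2 * delta) <= 2 * D * (C * mu).
  by apply: le_trans R0big (le_trans main _); rewrite ler_pM2l ?mulr_gt0.
rewrite ler_pdivrMr ?mulr_gt0 //.
have -> : 2 * D * (C * mu) * (2 * delta) = D * (4 * delta * C) * mu by ring.
by [].
Qed.

End LargeGraphs.

Unset Implicit Arguments.

Theorem proposition13p1 (R : realType) :
  exists a1 a2 c1 c2 : R,
    [/\ 0 < a1, a1 <= a2, 0 < c1, c1 <= c2 &
  forall d : nat, (3 <= d)%N ->
  exists b1 b2 tau B : R,
    [/\ 0 < b1, b1 <= b2, 0 < tau, 0 < B &
  forall n k : nat, (d <= n)%N -> (n <= k)%N -> ~~ odd (d * n)%N ->
  let logn : R := ln n%:R in
  let logk : R := ln k%:R in
  let D : R := 3%:R * logn / Num.min logn (ln logk) in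
  let L : R := logn ^+ 2 * ln logn * Num.min n%:R logk in
  exists (M : metricType R) (m : nat),
    let mM : R := Num.min logn (ln (ln m%:R)) in
    [/\ ([set: M] #= `I_m)%classic%card,
        expR (a1 * L) <= m%:R /\ m%:R <= expR (a2 * L),
        forall G : {set {set 'I_n}}, G \in regular_graphs n d ->
          graph_connected G -> (diam G)%:R <= 500%:R * logn ->
          (distortion M G <= D%:E)%E,
        c1 * Num.min logn (ln logk) <= mM /\
        mM <= c2 * Num.min logn (ln logk) &
        (0 < #|regular_graphs n d|)%N ->
        1 - B / (n%:R `^ tau) <=
        uniform_pr R (regular_graphs n d)
          [set G : {set {set 'I_n}} |
             ((b1 * (logn / mM))%:E <= distortion M G)%E &&
             (distortion M G <= (b2 * (logn / mM))%:E)%E]%SET]]].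
Proof.
have c4 := doubly_log_const_ge4 R; set c2 := doubly_log_const R in c4.
have c20 : 0 < 3 * c2 by lra.
have lc2 := log_const_ge2 R.
exists 24, (size_const R), 1, c2; split=> //; first by rewrite /size_const; lra.
  by lra.
move=> d d3; have d0 : (0 < d)%N by apply: leq_trans d3.
have [K [n0 [B0 [K0 B0pos hexp]]]] := random_regular_expander R d3.
have [b [n1 [b0 hdist]]] := expander_distortion R d0 K0.
pose N := maxn n0 (maxn n1 4).
(* The minimum guarantees [b1 <= b2], and the summand [N] in [B] makes the probability bound trivial
   for [n < N]. *)
exists (Num.min b (3 * c2)), (3 * c2), (10%:R^-1), (B0 + N%:R); split.
- by rewrite lt_min b0.
- by rewrite ge_min lexx orbT.
- by rewrite invr_gt0.
- by rewrite ltr_wpDr.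
move=> n k dn nk odn logn logk D L.
(* The case [n = 3] would force [d = 3], and [d * n = 9] is odd. *)
have n4 : (4 <= n)%N.
  have n3 := leq_trans d3 dn; rewrite ltn_neqAle n3 andbT; apply: contraNneq odn => e.
  by have -> : d = 3%N; [apply/eqP; rewrite eqn_leq d3 e dn | rewrite -e].
have x1 : 1 < logn := x_gt1 R n4.
have x0 : 0 < logn := lt_trans ltr01 x1.
have mu0 : 0 < Num.min logn (ln logk) := mu_gt0 R n4 nk.
have [q [q0 nYq qD]] := embedding_exponent R n4 nk.
have [r [hr hm]] := embedding_dimension R n4 nk.
have [H hH] := coordinate_range R n.
have Y1 : 1 < Num.min n%:R logk := Y_gt1 R n4 nk.
pose I : finType := ('I_(maxn 1 (up_log 2 n)) * 'I_r)%type.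
have cI : #|I| = (maxn 1 (up_log 2 n) * r)%N by rewrite card_prod !card_ord.
rewrite -cI in hm.
exists (box R I H), (H.+1 ^ #|I|)%N => mM.
have [hsize /andP[mM1 mM2]] := size_bounds n4 nk hH hm.
(* Stated for diameter at most [H], so that it applies both to graphs of diameter at most
   [500 log n] and to the expanders in the probability estimate. *)
have upper (G : {set {set 'I_n}}) : graph_connected G -> (diam G <= H)%N ->
    (distortion (box R I H) G <= D%:E)%E.
  move=> conn dG.
  have HG u v : (gdist G u v <= H)%N by apply: leq_trans (gdist_le_diam _ _ _) dG.
  have nYq' : #|'I_n|%:R <= Num.min n%:R logk ^+ q by rewrite card_ord.
  have := @matousek_embedding R 'I_n G H q _ conn HG q0 (ltW Y1) nYq' r.
  rewrite card_ord => /(_ hr)[phi hphi].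
  have q1 : (0 < q.*2.-1)%N by case: (q) q0.
  apply: le_trans (@distortion_box_le R 'I_n I H G phi _ q1 hphi) _.
  by rewrite lee_fin.
split=> //.
- exact: card_box.
- move=> G _ conn dG; apply: upper => //; rewrite -(ler_nat R); apply: le_trans dG _.
  case/andP: hH => hH _; apply: le_trans hH; rewrite -/logn expr2.
  by apply: (ler_wpM2l (ler0n R 500)); rewrite ler_peMl // ltW.
- by rewrite mul1r.
move=> regpos; have mMpos : 0 < mM by apply: lt_le_trans mM1.
have pow0 : 0 < n%:R `^ (10%:R^-1) :> R by rewrite powR_gt0 // ltr0n; apply: leq_trans n4.
set Good := [set G | _]%SET.
(* For [n < N] the left side is at most 0, since [n^(1/10) <= n < N <= B]. *)
case: (leqP N n) => nN; last first.
  apply: le_trans (_ : 0 <= _); last by rewrite divr_ge0.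
  rewrite subr_le0 ler_pdivlMr // mul1r.
  apply: le_trans (_ : n%:R <= _).
    rewrite -[leRHS]powRr1 //; apply: ler_powR; last by rewrite invf_le1 // ler1n.
    by rewrite ler1n; apply: leq_trans n4.
  by rewrite ler_wpDl ?(ltW B0pos) // ler_nat ltnW.
have [n0n n1n] : (n0 <= n)%N /\ (n1 <= n)%N.
  by move: nN; rewrite !geq_max => /and3P[].
have hbad := hexp 'I_n; rewrite card_ord in hbad; have {hbad} := hbad n0n.
set Bad := [set G in _ | _]%SET => hbad.
have cover : (#|regular_graphs n d| <= #|regular_graphs n d :&: Good| + #|Bad|)%N.
  apply: leq_trans (leq_of_leqif (leq_card_setU _ _)).
  apply/subset_leq_card/fintype.subsetP => G GR; apply/setUP.
  have [xG|xG] := boolP (edge_expander G K); last by right; rewrite inE xG andbT.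
  left; apply/setIP; split=> //.
  have rG : regular G d by move: GR; rewrite inE => /andP[].
  have /andP[hm1 hm2] := hm; have /andP[hH1 _] := hH.
  have I0 : (0 < #|I|)%N.
    rewrite -(ltr0n R); apply: lt_le_trans hm1.
    by rewrite mulr_gt0 ?exprn_gt0 ?mulr_gt0 //; apply: lt_trans Y1.
  have [conn dG low] := hdist n k H I G n4 n1n nk hm2 I0 hH1 rG xG.
  rewrite inE; apply/andP; split.
    (* The lower bound passes from [mu] to [mM] by [mu <= mM]; the upper bound after it uses
       [mM <= c2 * mu]. *)
    apply: le_trans low; rewrite lee_fin; apply: ler_pM.
    - by rewrite le_min !ltW.
    - by rewrite divr_ge0 // ltW.
    - by rewrite ge_min lexx.
    - by rewrite ler_pM2l // lef_pV2.
  apply: le_trans (upper _ conn dG) _; rewrite lee_fin /D -!mulrA ler_pM2l // mulrCA.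
  by rewrite ler_pM2l // ler_pdivlMr // mulrC ler_pdivrMr.
have regR : 0 < #|regular_graphs n d|%:R :> R by rewrite ltr0n.
rewrite /uniform_pr ler_pdivlMr //.
move: cover; rewrite -(ler_nat R) natrD; move: hbad.
have -> : #|dreg 'I_n d| = #|regular_graphs n d| by [].
set w := #|regular_graphs n d|%:R; set p := n%:R `^ _ => h1 h2.
have h3 : #|Bad|%:R <= (B0 + N%:R) / p * w.
  by apply: le_trans h1 _; rewrite !ler_wpM2r ?invr_ge0 ?(ltW pow0) // lerDl.
by rewrite mulrBl mul1r lerBlDr (le_trans h2) // lerD2l.
Qed.
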